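(* In the case of a finite ensemble ($1<\alpha<\infty$), let $\Delta x_i=\hat x^{\mathrm a}_i-x^{\mathrm a}_i$ be the discrepancy between the analysis mean of the SPEnKF and that of the scalar Kalman filter. Then the term $\mathbb{E}[\Delta x_i]$: 1. converges to zero weakly (in probability) always in the step limit $i\to\infty$; 2. converges to zero strongly (almost surely) in the step limit when $\limsup_{i\to\infty}\frac{i+1}{S_i}<\infty$; and 3. is always zero when $\tilde x_0=x_0$ and the optimal inflation and the optimal correction are applied. Moreover, $\mathbb{E}[\Delta x_i^2]$ converges to zero weakly (in probability) always in the step limit.
   Context: Let $m_0,m_1,\dots$ be nonzero reals (the scalar model), $r>0$, $p_0,\tilde p_0>0$, and $x_0,\tilde x_0,x^{\mathrm t}_0\in\mathbb{R}$. The truth is $x^{\mathrm t}_{i+1}=m_ix^{\mathrm t}_i$, and each observation $y_i$ is drawn from $\mathcal N(x^{\mathrm t}_i,r)$. Set (empty products $=1$) $M_i=\prod_{j=0}^{i-1}m_j$, $S_i=\sum_{l=0}^iM_l^2$, $B_i=\sum_{l=0}^iM_ly_l$. Scalar Kalman filter: $x^{\mathrm f}_0=x_0$, $p^{\mathrm f}_0=p_0$, and for $i\ge0$: $k_i=\frac{p^{\mathrm f}_i}{p^{\mathrm f}_i+r}$, $x^{\mathrm a}_i=x^{\mathrm f}_i+k_i(y_i-x^{\mathrm f}_i)$, $p^{\mathrm a}_i=(1-k_i)p^{\mathrm f}_i$, $x^{\mathrm f}_{i+1}=m_ix^{\mathrm a}_i$, $p^{\mathrm f}_{i+1}=m_i^2p^{\mathrm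 a}_i$. SPEnKF (Scalar Pedagogical Ensemble Kalman Filter) with (perturbed) inputs $\tilde x_0,\tilde p_0$ and ensemble size $N=2\alpha$: the same recursion, with hatted quantities $\hat x^{\mathrm f}_i,\hat x^{\mathrm a}_i,\hat p^{\mathrm f}_i,\hat p^{\mathrm a}_i$ and the same observations, started from the mean $\tilde x_0$ and the random sample variance $\frac1N\sum_{j=1}^N a_j^2\sim\Gamma(\alpha,\alpha/\tilde p_0)$ (shape, rate) of $N$ anomalies $a_j$ sampled from $\mathcal N(0,\tilde p_0)$. $\mathbb{E}$ is the expectation over this random initial sample variance, with the observations held fixed, so $\mathbb{E}[\Delta x_i]$ and $\mathbb{E}[\Delta x_i^2]$ are functions of the (random) observations; weak and strong convergence refer to the observations. Optimal inflation and correction: let $\mathfrak E_{\alpha+1}(z)=e^zE_{\alpha+1}(z)$ with $E_n(z)=\int_1^\infty e^{-zt}t^{-n}dt$, which is strictly decreasing on $[0,\infty)$ with inverse $\mathfrak E_{\alpha+1}^{-1}$ defined on $(0,\alpha^{-1}]$, and set $$\theta_i=\left[\frac{S_ip_0}{\alpha r}\,\mathfrak E_{\alpha+1}^{-1}\left(\frac{S_ip_0}{\alpha(S_ip_0+r)}\right)\right]^{-1},\quad \phi_0=\theta_0,\quad \phi_{i+1}=\frac{\theta_{i+1}(S_i\theta_ip_0+r)}{\theta_i(S_i\theta_{i+1}p_0+r)},$$ $$\psi_{i+1}=\frac{M_{i+1}(B_i-S_i\tilde x_0)(\theta_{i+1}-\theta_i)p_0r}{(S_i\theta_{i+1}p_0+r)(S_i\theta_ip_0+r)}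 .$$ Applying them means that in the SPEnKF the initial variance is multiplied by $\phi_0$ and, for every $i\ge0$, before the analysis at step $i+1$, the forecast variance at step $i+1$ is multiplied by $\phi_{i+1}$ and $\psi_{i+1}$ is added to the forecast mean at step $i+1$.
   Formalization: Item 3 fails with the printed formulas, so in φ_{i+1} and ψ_{i+1} the symbol p_0 is read as the SPEnKF's random initial sample variance, and in θ_i the p_0 outside the inverse is read as p̃_0 (the p_0 inside the inverse is unchanged). *)

(* Defs.v *)
From HB Require Import structures.
From mathcomp Require Import all_boot all_order all_algebra.
From mathcomp Require Import all_classical all_reals all_analysis.
Set Implicit Arguments.
Unset Strict Implicit.
Unset Printing Implicit Defensive.
Import Order.TTheory GRing.Theory Num.Theory.
Import numFieldNormedType.Exports.

Local Open Scope classical_set_scope.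
Local Open Scope ring_scope.

(** * Probability *)

Definition mutually_independent (d : measure_display) (T : measurableType d)
    (R : realType) (P : probability T R) (I : eqType)
    (X : I -> {RV P >-> R}) : Prop :=
  forall (J : seq I) (A : I -> set R), uniq J ->
    (forall i, measurable (A i)) ->
    P (\bigcap_(i in [set` J]) X i @^-1` A i) =
      (\prod_(i <- J) P (X i @^-1` A i))%E.

(* The second argument of [normal_prob] is the standard deviation. *)
Definition independent_normal (d : measure_display) (T : measurableType d)
    (R : realType) (P : probability T R) (I : eqType)
    (X : I -> {RV P >-> R}) (mean : I -> R) (var : R) : Prop :=
  (forall i (A : set R), measurable A ->
     distribution P (X i) A = normal_prob (mean i) (Num.sqrt var) A) /\
  mutually_independent X.

(* Convergence to 0 is stated for extended-real-valued sequences, because the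
   library's expectation is extended-real-valued. *)
Definition cvg0_in_probability (d : measure_display) (T : measurableType d)
    (R : realType) (P : probability T R) (X : nat -> T -> \bar R) : Prop :=
  forall eps : R, 0 < eps ->
    P [set w | (eps%:E < `| X i w |)%E] @[i --> \oo] --> 0%E.

Definition cvg0_almost_surely (d : measure_display) (T : measurableType d)
    (R : realType) (P : probability T R) (X : nat -> T -> \bar R) : Prop :=
  {ae P, forall w, X i w @[i --> \oo] --> 0%E}.

(** * Scalar model and filters *)

Section filters.
Context {R : realType}.
Implicit Types (m y : nat -> R) (r x p z n : R) (i : nat).

Fixpoint truth m x i : R :=
  if i is j.+1 then m j * truth m x j else x.

Definition Mprod m i : R := \prod_(0 <= j < i) m j.
Definition Ssum m i : R := \sum_(0 <= l < i.+1) Mprod m l ^+ 2.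
Definition Bsum m y i : R := \sum_(0 <= l < i.+1) Mprod m l * y l.

(* States of a filter are pairs (mean, variance). *)
Definition gain r p : R := p / (p + r).

Definition analysis r (yi : R) (f : R * R) : R * R :=
  (f.1 + gain r f.2 * (yi - f.1), (1 - gain r f.2) * f.2).

Definition propagate (mi : R) (a : R * R) : R * R :=
  (mi * a.1, mi ^+ 2 * a.2).

Fixpoint kf_forecast m r y x p i : R * R :=
  if i is j.+1 then
    propagate (m j) (analysis r (y j) (kf_forecast m r y x p j))
  else (x, p).

Definition kf_analysis_mean m r y x p i : R :=
  (analysis r (y i) (kf_forecast m r y x p i)).1.

(* The same recursion with variance inflation [phi] and mean correction [psi];
   [psi] is used at positive indices only. *)
Fixpoint corrected_forecast m r y x p (phi psi : nat -> R) i : R * R :=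
  if i is j.+1 then
    let f := propagate (m j)
               (analysis r (y j) (corrected_forecast m r y x p phi psi j)) in
    (f.1 + psi i, phi i * f.2)
  else (x, phi 0%N * p).

Definition corrected_analysis_mean m r y x p (phi psi : nat -> R) i : R :=
  (analysis r (y i) (corrected_forecast m r y x p phi psi i)).1.

(** * Optimal inflation and correction *)

Definition expint n z : R :=
  \int[lebesgue_measure]_(t in `[1, +oo[) (expR (- z * t) * t `^ (- n)).

Definition scaled_expint n z : R := expR z * expint n z.

Definition scaled_expint_inv n : R -> R :=
  'pinv_(fun=> 0) `[0, +oo[ (scaled_expint n).

(* The first occurrence of the initial variance is the scale [pt] of the law
   Gamma(alpha, alpha / pt) of the sample variance, the other two are the
   initial variance [p] of the Kalman filter: [theta] is characterized by
   E[S theta v / (S theta v + r)] = S p / (S p + r), v ~ Gamma(alpha, alpha/pt).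
   For [pt = p] both are the same symbol. *)
Definition theta alpha r p (pt : R) m i : R :=
  (Ssum m i * pt / (alpha * r) *
   scaled_expint_inv (alpha + 1)
     (Ssum m i * p / (alpha * (Ssum m i * p + r))))^-1.

(* In [opt_inflation] and [opt_correction], [v] is the initial variance of the
   filter which is being corrected. *)
Definition opt_inflation (th : nat -> R) m r (v : R) i : R :=
  if i is j.+1 then
    th i * (Ssum m j * th j * v + r) / (th j * (Ssum m j * th i * v + r))
  else th 0%N.

Definition opt_correction (th : nat -> R) m r y x (v : R) i : R :=
  if i is j.+1 then
    Mprod m i * (Bsum m y j - Ssum m j * x) * (th i - th j) * v * r /
    ((Ssum m j * th i * v + r) * (Ssum m j * th j * v + r))
  else 0.

End filters.

(* The anomalies are drawn from a centered law, hence no empirical mean is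
   subtracted. *)
Definition sample_variance (R : realType) (T : Type) (N : nat)
    (a : 'I_N -> T -> R) (e : T) : R :=
  N%:R^-1 * \sum_(j < N) a j e ^+ 2.

(* Main.v *)
Require Import Defs.
From HB Require Import structures.
From mathcomp Require Import all_boot all_order all_algebra.
From mathcomp Require Import all_classical all_reals all_analysis.
From mathcomp Require Import measurable_realfun.
From mathcomp Require Import ring lra.
Set Implicit Arguments.
Unset Strict Implicit.
Unset Printing Implicit Defensive.
Import Order.TTheory GRing.Theory Num.Theory.
Import numFieldNormedType.Exports.

Local Open Scope classical_set_scope.
Local Open Scope ring_scope.

(* Unrolling both filters gives, with [W_i = \sum_(l <= i) M_l (y_l - truth_l)],
   [b = xt0 - xtrue0], [b0 = x0 - xtrue0] and [v] the sample variance,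
     [Delta x_i = M_i r ((b - W_i / S_i) / (r + S_i v)
                         - (b0 - W_i / S_i) / (r + S_i p0))],
   so its first two moments over the ensemble are polynomials in [W_i], whose
   second moment is O(S_i). As [E (1 / v)] is finite for [1 < alpha],
   [E (1 / (r + S_i v)) = O(1 / S_i)], and [E ((M_i / (r + S_i v))^2)] tends to
   0 by dominated convergence, with [1 / (r v)] as bound because [M_i^2 <= S_i]. The series
   [\sum_i (M_i / S_i)^2] is dominated by a telescoping one; hence
   [M_i / S_i --> 0], and the noise term of [E (Delta x_i)] has summable second
   moments, whence almost sure convergence.
   The law of [v] enters only through the Laplace transform [(1 + l)^(- alpha)]
   of [w = alpha v / pt0]: writing [1 / (z + w)] as an integral of exponentials,
   Tonelli's theorem and an integration by parts give
   [E (w / (z + w)) = alpha e^z E_(alpha+1)(z)], which is the equation that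
   defines [theta]. The corrections turn the filter into the plain one started
   from the variance [theta_i v]. *)

(** * Integration against a measure given by a density along a map *)

Section density.
Local Open Scope ereal_scope.
Context d d' (T : measurableType d) (T' : measurableType d') (R : realType).
Variables (mu : {measure set T -> \bar R}) (nu : {measure set T' -> \bar R}).
Variables (X : T -> T') (g : T -> R).
Hypotheses (mX : measurable_fun setT X) (mg : measurable_fun setT g).
Hypothesis g0 : forall x, (0 <= g x)%R.
Hypothesis gX : forall A, measurable A ->
  \int[mu]_x (g x * \1_A (X x))%:E = nu A.

Import HBNNSimple.

(** Hypothesis [gX] is the case of indicators; linearity carries it to simple functions and monotone
    convergence to [f]. With [X] the identity this treats laws having a density; with [g] a product
    of other factors it upgrades one factor at a time under independence. *)
Lemma ge0_integral_density (f : T' -> \bar R) :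
  measurable_fun setT f -> (forall y, 0 <= f y) ->
  \int[mu]_x ((g x)%:E * f (X x)) = \int[nu]_y f y.
Proof.
move=> mf f0; pose h := nnsfun_approx measurableT mf.
have hX n : measurable_fun setT (fun x => h n (X x)).
  by apply: (measurableT_comp (measurable_funPT (h n))).
have -> : \int[nu]_y f y = limn (fun n => \int[nu]_y (h n y)%:E).
  rewrite -monotone_convergence//.
  - apply: eq_integral => y _; apply/esym/cvg_lim => //.
    by apply: cvg_nnsfun_approx.
  - by move=> n; exact/measurable_EFinP.
  - by move=> n x _; rewrite lee_fin.
  - by move=> x _ a b ab; rewrite lee_fin; exact/lefP/nd_nnsfun_approx.
have -> : \int[mu]_x ((g x)%:E * f (X x)) =
    limn (fun n => \int[mu]_x ((g x)%:E * (h n (X x))%:E)).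
  rewrite -monotone_convergence//.
  - apply: eq_integral => y _; apply/esym/cvg_lim => //.
    by apply: cvgeZl => //; exact: cvg_nnsfun_approx.
  - by move=> n; apply: emeasurable_funM; exact/measurable_EFinP.
  - by move=> n x _; rewrite mule_ge0 ?lee_fin.
  - move=> x _ a b ab; rewrite lee_wpmul2l ?lee_fin//.
    exact/lefP/nd_nnsfun_approx.
congr (limn _); apply/funext => n.
have m1 r : measurable (h n @^-1` [set r]) by [].
have mi r : measurable_fun setT (fun x => \1_(h n @^-1` [set r]) (X x) : R).
  by apply: (measurableT_comp _ mX); exact: measurable_indic.
have -> : \int[nu]_y (h n y)%:E =
    \sum_(r \in range (h n)) r%:E * nu (h n @^-1` [set r]).
  under eq_integral do rewrite fimfunE -fsumEFin//.
  rewrite ge0_integral_fsum//; last 2 first.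
  - by move=> y; exact/measurable_EFinP/measurable_funM.
  - by move=> y x _; rewrite nnfun_muleindic_ge0.
  apply: eq_fsbigr => r _; rewrite integralZl_indic_nnsfun//.
  by rewrite integral_indic// setIT.
transitivity (\int[mu]_x \sum_(r \in range (h n))
    (g x * (r * \1_(h n @^-1` [set r]) (X x)))%:E).
  apply: eq_integral => x _; rewrite [in LHS]fimfunE -fsumEFin//.
  rewrite ge0_mule_fsumr//; last by move=> r; exact: nnfun_muleindic_ge0.
rewrite ge0_integral_fsum//; last 2 first.
- by move=> r; apply/measurable_EFinP; do 2 apply: measurable_funM => //.
- move=> r x _; rewrite EFinM mule_ge0 ?lee_fin//.
  exact: (nnfun_muleindic_ge0 (h n) r (X x)).
(* Writing the coefficient as an attained value [h n y] makes its nonnegativity visible, so that it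
   can leave the integral. *)
apply: eq_fsbigr => r; rewrite inE => -[y _ <-].
under eq_integral do rewrite mulrCA EFinM.
rewrite ge0_integralZl ?lee_fin ?gX//.
- by apply/measurable_EFinP; apply: measurable_funM.
- by move=> x _; rewrite lee_fin mulr_ge0.
Qed.

End density.

(** * Expectations of products of independent variables *)

Section independence.
Context d (T : measurableType d) (R : realType) (P : probability T R).

Lemma expectation_normal (X : {RV P >-> R}) (mean s : R) (f : R -> R) :
  (forall A, measurable A -> distribution P X A = normal_prob mean s A) ->
  measurable_fun setT f -> (forall x, 0 <= f x) ->
  ('E_P[f \o X] = \int[lebesgue_measure]_x (normal_pdf mean s x * f x)%:E)%E.
Proof.
move=> dX mf f0; rewrite unlock.
rewrite -(@ge0_integral_distribution _ _ _ _ _ P X (EFin \o f)); last 2 first.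
- exact/measurable_EFinP.
- by move=> y; rewrite lee_fin.
rewrite -(@ge0_integral_density _ _ _ _ _ lebesgue_measure (distribution P X)
  idfun (normal_pdf mean s) _ _ _ _ (EFin \o f))//.
- by move=> _ A mA; rewrite setTI.
- exact: measurable_normal_pdf.
- by move=> x; exact: normal_pdf_ge0.
- move=> A mA; rewrite [RHS]dX// /normal_prob [RHS]integral_mkcond.
  apply: eq_integral => x _; rewrite patchE indicE.
  by case: ifP; rewrite ?mulr1 ?mulr0.
- exact/measurable_EFinP.
Qed.

Variables (I : eqType) (X : I -> {RV P >-> R}).

(* The induction is on the number of indices whose indicator function has
   already been replaced by an arbitrary function. *)
Lemma independent_integral_prod_indic (f : I -> R -> R) (e : I -> R) :
  mutually_independent X ->
  (forall i, measurable_fun setT (f i)) -> (forall i x, 0 <= f i x) ->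
  (forall i, ('E_P[f i \o X i] = (e i)%:E)%E) ->
  forall (J K : seq I) (A : I -> set R), uniq (J ++ K) ->
  (forall i, measurable (A i)) ->
  (\int[P]_w ((\prod_(i <- J) f i (X i w)) * \prod_(i <- K) \1_(A i) (X i w))%:E
   = (\prod_(i <- J) e i)%:E * \prod_(i <- K) P (X i @^-1` A i))%E.
Proof.
move=> indep mf f0 fe; elim=> [|j J IH] K A JK mA.
  rewrite big_nil mul1e -(indep _ _ JK mA).
  under eq_integral.
    move=> w _; rewrite big_nil mul1r.
    rewrite (_ : \prod_(i <- K) _ =
      \1_(\bigcap_(i in [set` K]) X i @^-1` A i) w); last first.
      rewrite indicE; have [wK|wK] := boolP (w \in _).
        rewrite inE in wK.
        by rewrite big_seq big1// => i iK; rewrite indicE mem_set//; exact: wK.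
      suff [i [iK iA]] : exists i, i \in K /\ ~ A i (X i w).
        rewrite (perm_big _ (perm_to_rem iK)) big_cons indicE memNset//.
        by rewrite /= mul0r.
      apply: contrapT => H; move: wK => /negP; apply; rewrite inE => i iK.
      by apply: contrapT => iA; apply: H; exists i.
    over.
  rewrite integral_indic ?setIT//.
  apply: fin_bigcap_measurable => // i _.
  by rewrite -[X in measurable X]setTI; exact: measurable_funPT.
have JKj : uniq (J ++ j :: K).
  by rewrite (perm_uniq (permEl (perm_catCA J [:: j] K))).
have jK : j \notin K by move: JK; rewrite /= mem_cat negb_or => /andP[/andP[]].
pose g w := (\prod_(i <- J) f i (X i w)) * \prod_(i <- K) \1_(A i) (X i w).
pose c := ((\prod_(i <- J) e i)%:E * \prod_(i <- K) P (X i @^-1` A i))%E.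
have mX i : measurable_fun setT (X i) by [].
have mg : measurable_fun setT g.
  apply: measurable_funM; apply: measurable_prod => i _.
    exact: measurableT_comp.
  by apply: measurableT_comp => //; exact: measurable_indic.
have g0 w : 0 <= g w by rewrite mulr_ge0// prodr_ge0.
have e0 i : 0 <= e i.
  by rewrite -lee_fin -fe; apply: expectation_ge0 => w /=.
(* [mscale] takes a nonnegative real as its factor, so the finite constant [c] is repackaged. *)
have [c' c'E] : exists c' : {nonneg R}, c = c'%:num%:E.
  have pfin : (\prod_(i <- K) P (X i @^-1` A i))%E \is a fin_num.
    elim/big_ind : _ => // [x y xf yf|i _]; first by rewrite fin_numM.
    apply: fin_num_measure.
    by rewrite -[X in measurable X]setTI; exact: measurable_funPT.
  have pge : (0 <= \prod_(i <- K) P (X i @^-1` A i))%E.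
    by apply: prode_ge0 => i _; exact: measure_ge0.
  have cge : 0 <= (\prod_(i <- J) e i) * fine (\prod_(i <- K) P (X i @^-1` A i))%E.
    by rewrite mulr_ge0 ?fine_ge0// prodr_ge0.
  by exists (NngNum cge); rewrite /c /= EFinM fineK.
(* Weighted by the remaining factors [g], the law of [X j] is only multiplied by the constant [c].
   This is the induction hypothesis with [j] moved to the indicator side; [A'] can be set to [B] at
   [j] without disturbing the other sets, because [j] is not in [K]. *)
have gX B : measurable B -> (\int[P]_w (g w * \1_B (X j w))%:E =
    mscale c' (distribution P (X j)) B)%E.
  move=> mB; rewrite /mscale /= -c'E.
  pose A' i := if i == j then B else A i.
  have mA' i : measurable (A' i) by rewrite /A'; case: ifP.
  have nK : forall i, i \in K -> A' i = A i.
    by move=> i iK; rewrite /A'; case: eqP => // ij; rewrite -ij iK in jK.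
  have := IH (j :: K) A' JKj mA'.
  rewrite big_cons {2}/A' eqxx (eq_big_seq (fun i => P (X i @^-1` A i))); last first.
    by move=> i iK; rewrite nK.
  move=> IHw; rewrite /c muleAC -muleA; apply: etrans IHw.
  apply: eq_integral => w _; rewrite big_cons; congr (_%:E).
  rewrite [X in _ = _ * (_ * X)](eq_big_seq (fun i => \1_(A i) (X i w))).
    by rewrite /A' eqxx /g -mulrA; congr (_ * _); rewrite mulrC.
  by move=> i iK; rewrite nK.
transitivity (\int[P]_w ((g w)%:E * (EFin \o f j) (X j w)))%E.
  by apply: eq_integral => w _; rewrite -EFinM big_cons /g -mulrA mulrC.
rewrite (ge0_integral_density (mX j) mg g0 gX); last 2 first.
- exact/measurable_EFinP.
- by move=> x; rewrite lee_fin.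
rewrite ge0_integral_mscale//; last 2 first.
- exact/measurable_EFinP.
- by move=> x _; rewrite lee_fin.
rewrite -c'E ge0_integral_distribution; last 2 first.
- exact/measurable_EFinP.
- by move=> x; rewrite lee_fin.
have -> : (\int[P]_w ((EFin \o f j) \o X j) w = (e j)%:E)%E by rewrite -fe unlock.
by rewrite /c big_cons EFinM muleC muleA.
Qed.

Lemma independent_expectation_prod (J : seq I) (f : I -> R -> R) (e : I -> R) :
  mutually_independent X -> uniq J ->
  (forall i, measurable_fun setT (f i)) -> (forall i x, 0 <= f i x) ->
  (forall i, ('E_P[f i \o X i] = (e i)%:E)%E) ->
  ('E_P[(fun w => \prod_(i <- J) f i (X i w))%R] = (\prod_(i <- J) e i)%:E)%E.
Proof.
move=> indep uJ mf f0 fe; rewrite unlock.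
have := @independent_integral_prod_indic f e indep mf f0 fe J [::] (fun=> setT).
rewrite cats0 big_nil mule1 => <-//.
by apply: eq_integral => w _; rewrite big_nil mulr1.
Qed.

End independence.

(** * Laplace transforms of a normal variable and of its square *)

Section gaussian_transforms.
Context d (T : measurableType d) (R : realType) (P : probability T R).

Lemma normal_peak_div (s c : R) : 0 < c ->
  normal_peak (s / c) = c * normal_peak s.
Proof.
move=> c0; rewrite /normal_peak exprMn.
rewrite (_ : _ * _ *+ 2 = (s ^+ 2 * pi *+ 2) * (c^-1 ^+ 2)).
  rewrite sqrtrM; last by rewrite mulrn_wge0// mulr_ge0 ?sqr_ge0 ?pi_ge0.
  by rewrite sqrtr_sqr ger0_norm ?invr_ge0 ?(ltW c0)// invfM invrK mulrC.
by ring.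
Qed.

(** The tilted density is (1 + l)^(-1/2) times the centered normal density of variance var / (1 +
    l), whose total mass is 1. *)
Lemma normal_laplace_sqr (X : {RV P >-> R}) (var l : R) :
  0 < var -> 0 <= l ->
  (forall A, measurable A ->
    distribution P X A = normal_prob 0 (Num.sqrt var) A) ->
  ('E_P[(fun x => expR (- l * (x ^+ 2 / (2 * var)))) \o X] =
   ((1 + l) `^ (- 2^-1))%:E)%E.
Proof.
move=> v0 l0 dX.
have c0 : 0 < Num.sqrt (1 + l) by rewrite sqrtr_gt0 ltr_pwDl.
have s0 : Num.sqrt var != 0 by rewrite gt_eqF ?sqrtr_gt0.
have cs0 : Num.sqrt var / Num.sqrt (1 + l) != 0.
  by rewrite mulf_neq0// invr_neq0// gt_eqF.
rewrite (expectation_normal dX); last 2 first.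
- apply: measurableT_comp => //; apply: measurable_funM => //.
  by apply: measurable_funM => //; exact: measurable_funX.
- by move=> x; exact: expR_ge0.
under eq_integral => x _.
  rewrite (_ : normal_pdf _ _ _ * _ = (Num.sqrt (1 + l))^-1 *
    normal_pdf 0 (Num.sqrt var / Num.sqrt (1 + l)) x); last first.
    rewrite !normal_pdfE// normal_peak_div// -!mulrA mulKf ?gt_eqF//.
    congr (_ * _); rewrite /normal_fun -expRD; congr expR.
    rewrite exprMn exprVn !sqr_sqrtr ?addr_ge0// ?ltW// subr0.
    by field; rewrite !gt_eqF// ltr_pwDl.
  rewrite EFinM; over.
rewrite ge0_integralZl ?lee_fin ?invr_ge0 ?expR_ge0 ?(ltW c0)//; last 2 first.
- by apply/measurable_EFinP; exact: measurable_normal_pdf.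
- by move=> x _; rewrite lee_fin normal_pdf_ge0.
rewrite integral_normal_pdf mule1; congr (_%:E).
by rewrite powRN powR12_sqrt// addr_ge0.
Qed.

(** Completing the square: the tilt moves the mean by [t * var] and leaves the factor exp(t^2 var /
    2). *)
Lemma normal_mgf_center (X : {RV P >-> R}) (mean var t : R) :
  0 < var ->
  (forall A, measurable A ->
    distribution P X A = normal_prob mean (Num.sqrt var) A) ->
  ('E_P[(fun x => expR (t * (x - mean))) \o X] =
   (expR (t ^+ 2 * var / 2))%:E)%E.
Proof.
move=> v0 dX.
have s0 : Num.sqrt var != 0 by rewrite gt_eqF ?sqrtr_gt0.
rewrite (expectation_normal dX); last 2 first.
- apply: measurableT_comp => //; apply: measurable_funM => //.
  exact: measurable_funB.
- by move=> x; exact: expR_ge0.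
under eq_integral => x _.
  rewrite (_ : normal_pdf _ _ _ * _ = expR (t ^+ 2 * var / 2) *
    normal_pdf (mean + t * var) (Num.sqrt var) x); last first.
    rewrite !normal_pdfE// [RHS]mulrCA -!mulrA.
    congr (_ * _); rewrite /normal_fun -!expRD; congr expR.
    rewrite !sqr_sqrtr ?ltW//.
    by field; rewrite !gt_eqF.
  rewrite EFinM; over.
rewrite ge0_integralZl ?lee_fin ?expR_ge0//; last 2 first.
- by apply/measurable_EFinP; exact: measurable_normal_pdf.
- by move=> x _; rewrite lee_fin normal_pdf_ge0.
by rewrite integral_normal_pdf mule1.
Qed.

End gaussian_transforms.

(** * The scaled exponential integral and its inverse *)

Section tilted_exponential_integral.
Context {R : realType}.
Implicit Types a n z t q : R.

Let mu := @lebesgue_measure R.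

(** The factor e^z of the scaled integral is absorbed into the exponent, so that the kernel equals 1
    at t = 1 for all n and z. *)
Let kernel n z t := expR (- (z * (t - 1))) * t `^ (- n).

Let is_derive_kernel n z t : 0 < t ->
  is_derive t 1 (kernel n z) (- (z * kernel n z t + n * kernel (n + 1) z t)).
Proof.
move=> t0; pose g t := - (z * (t - 1)).
have dg : is_derive t 1 g (- z).
  have -> : g = - (z \*: (id - cst 1)) by apply/funext.
  by apply: is_derive_eq; rewrite subr0 scaler1.
have de : is_derive t 1 (expR \o g) (- z * expR (g t)).
  by apply: is_derive_eq; rewrite mulrC.
have dp : is_derive t 1 (fun t => t `^ (- n)) (- n * t `^ (- n - 1)).
  exact: is_derive1_powR.
rewrite [X in is_derive _ _ X](_ : _ = (expR \o g) * (fun t => t `^ (- n)))//.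
apply: is_derive_eq; rewrite /kernel -/(g t) [- (n + 1)]opprD /GRing.scale /=.
by ring.
Qed.

Let derivable_kernel n z t : 0 < t -> derivable (kernel n z) t 1.
Proof. by move=> t0; have [] := is_derive_kernel n z t0. Qed.

Let continuous_kernel n z t : 0 < t -> {for t, continuous (kernel n z)}.
Proof.
by move=> t0; apply/differentiable_continuous/derivable1_diffP/derivable_kernel.
Qed.

Let kernel_ge0 n z t : 0 <= kernel n z t.
Proof. by rewrite mulr_ge0 ?expR_ge0 ?powR_ge0. Qed.

Let measurable_kernel n z (D : set R) : measurable_fun D (kernel n z).
Proof.
apply: measurable_funTS; apply: measurable_funM => //.
apply: measurableT_comp => //; apply: measurable_funN.
by apply: measurable_funM => //; exact: measurable_funB.
Qed.

Let kernel_le n z t : 0 <= n -> 0 <= z -> 1 <= t ->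
  kernel n z t <= expR (- (z * (t - 1))).
Proof.
move=> n0 z0 t1; rewrite ler_piMr ?expR_ge0// powRN.
rewrite invf_le1 ?powR_gt0 ?(lt_le_trans _ t1)//.
by rewrite -(powRr0 t) ler_powR.
Qed.

Let kernel_decr n z z' t : z <= z' -> 1 <= t -> kernel n z' t <= kernel n z t.
Proof.
move=> zz' t1; rewrite ler_wpM2r ?powR_ge0// ler_expR lerN2.
by rewrite ler_wpM2r// subr_ge0.
Qed.

Let kernel_cvg0 n z : 0 <= z -> 0 < n -> kernel n z t @[t --> +oo] --> 0.
Proof.
move=> z0 n0; apply/cvgrPdist_le => e e0; near=> t.
have t1 : 1 <= t by near: t; exact: nbhs_pinfty_ge.
have t0 : 0 < t := lt_le_trans ltr01 t1.
rewrite sub0r normrN ger0_norm//.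
apply: (le_trans (kernel_decr n z0 t1)); rewrite /kernel mul0r oppr0 expR0 mul1r.
rewrite powRN invf_ple ?posrE ?powR_gt0//.
(* Seen as the n-th power of (1 / e)^(1 / n), the bound 1 / e is below t^n as soon as t exceeds that
   root. *)
rewrite -[leLHS]powRr1 ?invr_ge0 ?(ltW e0)// -(mulVf (lt0r_neq0 n0)) powRrM.
apply: ge0_ler_powR; rewrite ?nnegrE ?powR_ge0 ?(ltW n0) ?(ltW t0)//.
Unshelve. all: by end_near. Qed.

Let kernel0_cvg0 z : 0 < z -> kernel 0 z t @[t --> +oo] --> 0.
Proof.
move=> z0; apply/cvgrPdist_le => e e0; near=> t.
have t1 : 1 <= t by near: t; exact: nbhs_pinfty_ge.
rewrite sub0r normrN ger0_norm//.
rewrite (le_trans (kernel_le (lexx 0) (ltW z0) t1))//.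
rewrite expRN invf_ple ?posrE ?expR_gt0//.
apply: (@le_trans _ _ (z * (t - 1))); last first.
  by apply: le_trans (expR_ge1Dx _); rewrite lerDr.
rewrite -ler_pdivrMl// lerBrDr.
by near: t; apply: nbhs_pinfty_ge; exact: num_real.
Unshelve. all: by end_near. Qed.

(** The integrand is the derivative of the opposite of the kernel, which rises from -1 at t = 1 to 0
    at infinity. Taking the decay as a hypothesis covers both n > 0 and the pure exponential n =
    0. *)
Let integral_kernel_FTC n z : 0 <= n -> 0 <= z -> kernel n z t @[t --> +oo] --> 0 ->
  (\int[mu]_(t in `[1%R, +oo[) (z * kernel n z t + n * kernel (n + 1) z t)%:E = 1)%E.
Proof.
move=> n0 z0 k0.
have dk t : 0 < t -> is_derive t 1 (- kernel n z)
    (z * kernel n z t + n * kernel (n + 1) z t).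
  move=> t0; have := is_derive_kernel n z t0 => dk.
  by apply: is_derive_eq; rewrite opprK.
rewrite (@ge0_continuous_FTC2y _ _ (- kernel n z) 1 0).
- rewrite sub0e /kernel fctE subrr mulr0 oppr0 expR0 powR1 mulr1.
  by rewrite EFinN oppeK.
- by move=> t t1; rewrite addr_ge0// mulr_ge0.
- apply: continuous_in_subspaceT => t; rewrite inE/= in_itv/= andbT => t1.
  have t0 : 0 < t by rewrite (lt_le_trans _ t1).
  by apply: cvgD; apply: cvgMr; exact: continuous_kernel.
- by rewrite -oppr0; exact: cvgN.
- by move=> t t1; have [] := dk t (lt_trans ltr01 t1).
- apply: cvg_at_right_filter; apply: cvgN; exact: continuous_kernel.
- move=> t; rewrite in_itv/= andbT => t1; rewrite derive1E.
  by have dkt := dk t (lt_trans ltr01 t1); rewrite derive_val.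
Qed.

(** This is e^z E_n(z), kept extended-real so that Tonelli's theorem and the recurrence apply before
    finiteness is known; [scaled_expintE] makes the identification. *)
Definition tilted_expint n z : \bar R :=
  (\int[mu]_(t in `[1%R, +oo[) (expR (- (z * (t - 1))) * t `^ (- n))%:E)%E.

Lemma tilted_expint_ge0 n z : (0 <= tilted_expint n z)%E.
Proof. by apply: integral_ge0 => t _; rewrite lee_fin; exact: kernel_ge0. Qed.

Let tilted_expint_FTC n z : 0 <= n -> 0 <= z -> kernel n z t @[t --> +oo] --> 0 ->
  (z%:E * tilted_expint n z + n%:E * tilted_expint (n + 1) z = 1)%E.
Proof.
move=> n0 z0 k0; rewrite -(integral_kernel_FTC n0 z0 k0) /tilted_expint.
rewrite -!ge0_integralZl ?lee_fin//; first last.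
- by move=> t _; rewrite lee_fin; exact: kernel_ge0.
- by apply/measurable_EFinP; exact: measurable_kernel.
- by move=> t _; rewrite lee_fin; exact: kernel_ge0.
- by apply/measurable_EFinP; exact: measurable_kernel.
rewrite -ge0_integralD//.
- by move=> t _; rewrite -EFinM lee_fin mulr_ge0//; exact: kernel_ge0.
- apply/measurable_EFinP; apply: measurable_funM => //; exact: measurable_kernel.
- by move=> t _; rewrite -EFinM lee_fin mulr_ge0//; exact: kernel_ge0.
- apply/measurable_EFinP; apply: measurable_funM => //; exact: measurable_kernel.
Qed.

(** The classical recurrence n E_(n+1)(z) = e^(-z) - z E_n(z), multiplied by e^z and written without
    subtraction. *)
Lemma tilted_expint_rec n z : 0 < n -> 0 <= z ->
  (z%:E * tilted_expint n z + n%:E * tilted_expint (n + 1) z = 1)%E.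
Proof. by move=> n0 z0; exact: tilted_expint_FTC (ltW n0) z0 (kernel_cvg0 z0 n0). Qed.

Lemma integral_exp_tail z : 0 < z ->
  (\int[mu]_(t in `[1%R, +oo[) (expR (- (z * (t - 1))))%:E = (z^-1)%:E)%E.
Proof.
move=> z0; have := tilted_expint_FTC (lexx 0) (ltW z0) (kernel0_cvg0 z0).
rewrite mul0e adde0 /tilted_expint.
under eq_integral do rewrite oppr0 powRr0 mulr1.
move=> /(congr1 (fun x => (z^-1)%:E * x)%E).
by rewrite muleA -EFinM mulVf ?gt_eqF// mul1e mule1.
Qed.

(** In the recurrence at n - 1, the positive multiple n - 1 of this integral is a nonnegative
    summand of 1. *)
Lemma tilted_expint_fin n z : 1 < n -> 0 <= z -> tilted_expint n z \is a fin_num.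
Proof.
move=> n1 z0; have n0 : 0 < n - 1 by rewrite subr_gt0.
have := tilted_expint_rec n0 z0; rewrite subrK => H.
rewrite ge0_fin_numE ?tilted_expint_ge0// ltey; apply/eqP => Jy.
move: H; rewrite Jy gt0_muley ?lte_fin// addey.
  by [].
by rewrite gt_eqF// (lt_le_trans (ltNyr 0))// mule_ge0 ?tilted_expint_ge0.
Qed.

Lemma tilted_expint0 n : 0 < n -> tilted_expint (n + 1) 0 = (n^-1)%:E.
Proof.
move=> n0; have := tilted_expint_rec n0 (lexx 0); rewrite mul0e add0e.
move=> /(congr1 (fun x => (n^-1)%:E * x)%E).
by rewrite muleA -EFinM mulVf ?gt_eqF// mul1e mule1.
Qed.

Lemma tilted_expint_leV n z : 0 <= n -> 0 < z -> (tilted_expint n z <= (z^-1)%:E)%E.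
Proof.
move=> n0 z0; rewrite -integral_exp_tail//; apply: ge0_le_integral => //.
- by move=> t _; rewrite lee_fin; exact: kernel_ge0.
- by apply/measurable_EFinP; exact: measurable_kernel.
- apply/measurable_EFinP; apply: measurable_funTS.
  apply: measurableT_comp => //; apply: measurable_funN.
  by apply: measurable_funM => //; exact: measurable_funB.
- move=> t; rewrite /= in_itv/= andbT => t1; rewrite lee_fin.
  exact: kernel_le (ltW z0) t1.
Qed.

Lemma tilted_expint_decr n z z' : z <= z' -> (tilted_expint n z' <= tilted_expint n z)%E.
Proof.
move=> zz'; apply: ge0_le_integral => //.
- by move=> t _; rewrite lee_fin; exact: kernel_ge0.
- by apply/measurable_EFinP; exact: measurable_kernel.
- by apply/measurable_EFinP; exact: measurable_kernel.
- move=> t; rewrite /= in_itv/= andbT => t1; rewrite lee_fin.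
  exact: kernel_decr.
Qed.

(** With h = z' - z, the kernels differ by at most h (t - 1) t^(-(n+1)) <= h t^(-n), and 1 / (n - 1)
    is the integral of t^(-n). This supplies the continuity used by the intermediate value
    theorem. *)
Lemma tilted_expint_lipschitz n z z' : 1 < n -> 0 <= z -> z <= z' ->
  fine (tilted_expint (n + 1) z) <=
  fine (tilted_expint (n + 1) z') + (z' - z) / (n - 1).
Proof.
move=> n1 z0 zz'; have n10 : 0 < n - 1 by rewrite subr_gt0.
have n11 : 1 < n + 1 by rewrite ltrDr (lt_trans ltr01).
have z'0 := le_trans z0 zz'.
rewrite -lee_fin EFinD EFinM !fineK ?tilted_expint_fin//.
have <- : (tilted_expint n 0 = ((n - 1)^-1)%:E)%E.
  by rewrite -tilted_expint0// subrK.
rewrite /tilted_expint -ge0_integralZl ?lee_fin ?subr_ge0//; first last.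
- by move=> t _; rewrite lee_fin; exact: kernel_ge0.
- by apply/measurable_EFinP; exact: measurable_kernel.
rewrite -ge0_integralD//; first last.
- apply/measurable_EFinP; apply: measurable_funM => //; exact: measurable_kernel.
- by move=> t _; rewrite -EFinM lee_fin mulr_ge0 ?subr_ge0//; exact: kernel_ge0.
- by apply/measurable_EFinP; exact: measurable_kernel.
- by move=> t _; rewrite lee_fin; exact: kernel_ge0.
apply: ge0_le_integral => //.
- by move=> t _; rewrite lee_fin; exact: kernel_ge0.
- by apply/measurable_EFinP; exact: measurable_kernel.
- apply/measurable_EFinP; apply: measurable_funD; first exact: measurable_kernel.
  by apply: measurable_funM => //; exact: measurable_kernel.
- move=> t; rewrite /= in_itv/= andbT => t1; rewrite -EFinM -EFinD lee_fin.
  have t0 : 0 < t := lt_le_trans ltr01 t1.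
  have tn : t `^ (- n) = t * t `^ (- (n + 1)).
    rewrite -{2}(powRr1 (ltW t0)) -powRD; last by rewrite (gt_eqF t0) implybT.
    by congr (_ `^ _); ring.
  rewrite mul0r oppr0 expR0 mul1r tn mulrA -mulrDl ler_wpM2r ?powR_ge0//.
  have : expR (- (z * (t - 1))) * (1 - (z' - z) * (t - 1)) <= expR (- (z' * (t - 1))).
    rewrite (_ : - (z' * (t - 1)) = - (z * (t - 1)) - (z' - z) * (t - 1)); last by ring.
    by rewrite expRD ler_wpM2l ?expR_ge0// expR_ge1Dx.
  have : expR (- (z * (t - 1))) <= 1.
    by rewrite expR_le1 oppr_le0 mulr_ge0// subr_ge0.
  have := expR_ge0 (- (z * (t - 1))).
  have : 0 <= (z' - z) by rewrite subr_ge0.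
  set E := expR _; set E' := expR _; move: (z' - z) => h h0 E0 E1.
  have ht : 0 <= h * (t - 1) by rewrite mulr_ge0// subr_ge0.
  have : E * (h * (t - 1)) <= h * (t - 1) by rewrite ler_piMl.
  lra.
Qed.

Lemma scaled_expintE n z : 1 < n -> 0 <= z ->
  scaled_expint n z = fine (tilted_expint n z).
Proof.
move=> n1 z0; rewrite /scaled_expint /expint /Rintegral.
have E : (tilted_expint n z = (expR z)%:E *
    \int[mu]_(t in `[1%R, +oo[) (expR (- z * t) * t `^ (- n))%:E)%E.
  rewrite -ge0_integralZl ?lee_fin ?expR_ge0//; first last.
  - by move=> t _; rewrite lee_fin mulr_ge0 ?expR_ge0 ?powR_ge0.
  - apply/measurable_EFinP; apply: measurable_funTS; apply: measurable_funM => //.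
    by apply: measurableT_comp => //; exact: measurable_funM.
  apply: eq_integral => t _; rewrite -EFinM mulrA -expRD; congr (_%:E).
  by congr (expR _ * _); ring.
set I := (\int[_]_(_ in _) _)%E in E *.
have -> : I = (((expR z)^-1)%:E * tilted_expint n z)%E.
  by rewrite E muleA -EFinM mulVf ?gt_eqF ?expR_gt0// mul1e.
rewrite fineM ?tilted_expint_fin//= mulrA mulfV ?gt_eqF ?expR_gt0//.
by rewrite mul1r.
Qed.

(** Intermediate values on [0, 1 / q]: the value at 0 is 1 / n, above q, and the bound by 1 / z
    gives at most q at z = 1 / q. *)
Lemma scaled_expint_surj n q : 1 < n -> 0 < q < n^-1 ->
  exists2 z, 0 < z & scaled_expint (n + 1) z = q.
Proof.
move=> n1 /andP[q0 qn]; have n0 := lt_trans ltr01 n1.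
have n11 : 1 < n + 1 by rewrite ltrDr.
have f0 : scaled_expint (n + 1) 0 = n^-1.
  by rewrite scaled_expintE// tilted_expint0.
have qV0 : 0 < q^-1 by rewrite invr_gt0.
have fq : scaled_expint (n + 1) q^-1 <= q.
  rewrite scaled_expintE ?(ltW qV0)// -lee_fin fineK ?tilted_expint_fin ?(ltW qV0)//.
  by rewrite -[q in leRHS]invrK tilted_expint_leV// ltW// addr_gt0.
have lip z z' : 0 <= z -> z <= z' ->
    `|scaled_expint (n + 1) z - scaled_expint (n + 1) z'| <= (z' - z) / (n - 1).
  move=> z0 zz'; have z'0 := le_trans z0 zz'; rewrite !scaled_expintE//.
  rewrite ger0_norm ?subr_ge0 ?fine_le ?tilted_expint_fin ?tilted_expint_decr//.
  by rewrite lerBlDl tilted_expint_lipschitz.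
have lip' z z' : 0 <= z -> 0 <= z' ->
    `|scaled_expint (n + 1) z - scaled_expint (n + 1) z'| <= `|z - z'| / (n - 1).
  move=> z0 z'0; have [zz'|/ltW zz'] := leP z z'.
    by rewrite distrC [`|z - _|]distrC [`|z' - z|]ger0_norm ?subr_ge0// distrC lip.
  by rewrite [`|z - _|]ger0_norm ?subr_ge0// distrC lip.
have cf : {within `[0, q^-1], continuous (scaled_expint (n + 1))}.
  apply/subspace_continuousP => z; rewrite /= in_itv/= => /andP[z0 _].
  apply/cvgrPdist_le => e e0.
  have d0 : 0 < e * (n - 1) by rewrite mulr_gt0// subr_gt0.
  exists (e * (n - 1)) => //= z' /= zz'; rewrite in_itv/= => /andP[z'0 _].
  by rewrite (le_trans (lip' _ _ z0 z'0))// ler_pdivrMr ?subr_gt0// ltW.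
have [] := IVT (ltW qV0) cf (v := q).
  rewrite f0; apply/andP; split; first by rewrite ge_min fq orbT.
  by rewrite le_max (ltW qn).
move=> z; rewrite in_itv/= => /andP[z0 _] fz; exists z => //.
rewrite lt_neqAle z0 andbT; apply/eqP => zE.
by move: qn; rewrite -fz -zE f0 ltxx.
Qed.

(** ['pinv_] returns a preimage in the half-line as soon as one exists. That preimage is not 0,
    because the value at 0 is 1 / n, which exceeds q. *)
Lemma scaled_expint_invP n q : 1 < n -> 0 < q < n^-1 ->
  0 < scaled_expint_inv (n + 1) q /\
  scaled_expint (n + 1) (scaled_expint_inv (n + 1) q) = q.
Proof.
move=> n1 qn; have [z z0 fz] := scaled_expint_surj n1 qn.
have n0 := lt_trans ltr01 n1.
have qi : q \in scaled_expint (n + 1) @` `[0, +oo[.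
  by rewrite inE; exists z => //=; rewrite in_itv/= andbT ltW.
set y := scaled_expint_inv _ _.
have fy : scaled_expint (n + 1) y = q by exact: pinvK.
have : y \in `[0, +oo[%classic.
  rewrite inE; apply: (surjpinv_image_sub (dflt := fun=> 0) (f := scaled_expint (n + 1))
    (B := scaled_expint (n + 1) @` `[0, +oo[)) => //.
  by exists q => //; exact: set_mem.
rewrite inE/= in_itv/= andbT => y0; split=> //.
rewrite lt_neqAle y0 andbT; apply/eqP => yE.
case/andP: qn => _; rewrite -fy -yE scaled_expintE ?tilted_expint0 ?ltxx//.
by rewrite ltrDr.
Qed.

End tilted_exponential_integral.

(** On nonnegative reals, inversion is the power with exponent -1, also at 0, where both give 0. *)
Lemma measurable_fun_inv_ge0 d (T : measurableType d) (R : realType) (f : T -> R) :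
  measurable_fun setT f -> (forall x, 0 <= f x) ->
  measurable_fun setT (fun x => (f x)^-1).
Proof.
move=> mf f0; rewrite (_ : (fun _ => _) = (powR (R := R))^~ (-1) \o f).
  by apply: measurableT_comp.
by apply/funext => x /=; rewrite powR_inv1.
Qed.

(** * Expectations under Gamma(alpha, 1), from its Laplace transform *)

Section gamma_law.
Context d (T : measurableType d) (R : realType) (P : probability T R).
Variables (alpha : R) (w : T -> R).
Hypotheses (alpha_gt1 : 1 < alpha) (mw : measurable_fun setT w).
Hypothesis w_ge0 : forall x, 0 <= w x.
Hypothesis laplace : forall l, 0 <= l ->
  (\int[P]_x (expR (- (l * w x)))%:E = ((1 + l) `^ (- alpha))%:E)%E.

Let mu := @lebesgue_measure R.

(** A reciprocal of c that is +oo at c = 0, unlike the inverse of the field, which is 0 there; its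
    finiteness therefore detects c > 0. *)
Let exp_tail (c : R) : \bar R :=
  (\int[mu]_(t in `[1%R, +oo[) (expR (- (c * (t - 1))))%:E)%E.

Let f z (p : T * measurableTypeR R) : \bar R :=
  (\1_`[1, +oo[ p.2 * expR (- ((z + w p.1) * (p.2 - 1))))%:E.

Let f_ge0 z p : (0 <= f z p)%E.
Proof. by rewrite lee_fin mulr_ge0 ?expR_ge0. Qed.

Let measurable_f z : measurable_fun setT (f z).
Proof.
apply/measurable_EFinP; apply: measurable_funM.
  by apply: measurableT_comp => //; exact: measurable_indic.
apply: measurableT_comp => //; apply: measurable_funN; apply: measurable_funM.
  apply: measurable_funD => //.
  by apply: (measurableT_comp mw); exact: measurable_fst.
by apply: measurable_funB => //; exact: measurable_snd.
Qed.

Let tailE z x : exp_tail (z + w x) = (\int[mu]_t f z (x, t))%E.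
Proof.
rewrite /exp_tail integral_mkcond; apply: eq_integral => t _.
by rewrite patchE /f /= indicE; case: ifP => _; rewrite ?mul1r ?mul0r.
Qed.

Let measurable_tail z : measurable_fun setT (fun x => exp_tail (z + w x)).
Proof.
under eq_fun do rewrite tailE.
exact: (measurable_fun_fubini_tonelli_F (f z)).
Qed.

(** After exchanging the integrals, the inner one is the Laplace transform at l = t - 1, that is
    t^(-alpha), times the tilt in z. *)
Let integral_tail z : 0 <= z ->
  (\int[P]_x exp_tail (z + w x) = tilted_expint alpha z)%E.
Proof.
move=> z0; under eq_integral do rewrite tailE.
rewrite (fubini_tonelli (f z))// /tilted_expint [RHS]integral_mkcond.
apply: eq_integral => t _; rewrite patchE; case: ifPn => tD.
  have t1 : 1 <= t by move: tD; rewrite inE /= in_itv /= andbT.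
  transitivity (\int[P]_x ((expR (- (z * (t - 1))))%:E *
      (expR (- ((t - 1) * w x)))%:E))%E.
    apply: eq_integral => x _.
    rewrite /f /= indicE tD mul1r -EFinM -expRD; congr (expR _)%:E; ring.
  rewrite ge0_integralZl ?lee_fin ?expR_ge0//.
  - rewrite laplace ?subr_ge0// -EFinM; congr (_ * _ `^ _)%:E; ring.
  - apply/measurable_EFinP; apply: measurableT_comp => //.
    by apply: measurable_funN; exact: measurable_funM.
by rewrite integral0_eq// => x _; rewrite /f /= indicE (negbTE tD) mul0r.
Qed.

(** At z = 0 the expectation of [exp_tail] is finite since [alpha] exceeds 1, so the integrand is
    finite almost everywhere, whereas it is +oo wherever [w] vanishes. *)
Lemma gamma_ae_gt0 : {ae P, forall x, 0 < w x}.
Proof.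
have : P.-integrable setT (fun x => exp_tail (0 + w x)).
  apply/integrableP; split => //.
  under eq_integral do rewrite gee0_abs ?integral_ge0//.
  by rewrite integral_tail// ltey_eq tilted_expint_fin.
move=> /integrable_ae => /(_ measurableT); apply: filterS => x /(_ Logic.I).
rewrite add0r => fx; rewrite lt_neqAle w_ge0 andbT; apply/eqP => wx.
move: fx; rewrite -wx /exp_tail.
under eq_integral do rewrite mul0r oppr0 expR0.
by rewrite integral_cst//= lebesgue_measure_itv/= ltry mul1e.
Qed.

Lemma gamma_expectation_inv : (\int[P]_x ((w x)^-1)%:E = ((alpha - 1)^-1)%:E)%E.
Proof.
rewrite -tilted_expint0 ?subr_gt0// subrK -integral_tail//.
(* The integrands disagree where [w] is 0, the field inverse being 0 and [exp_tail] infinite, so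
   equality holds only almost everywhere. *)
apply: ge0_ae_eq_integral => //.
- apply/measurable_EFinP; exact: measurable_fun_inv_ge0.
- by move=> x _; rewrite lee_fin invr_ge0.
- by move=> x _; exact: integral_ge0.
- apply: filterS gamma_ae_gt0 => x wx _.
  by rewrite add0r /exp_tail integral_exp_tail.
Qed.

(** The complementary ratio z / (z + w) has expectation [z * tilted_expint alpha z], and the
    recurrence says exactly what this lacks to reach 1. *)
Lemma gamma_expectation_ratio z : 0 < z ->
  (\int[P]_x (w x / (z + w x))%:E = (alpha * scaled_expint (alpha + 1) z)%:E)%E.
Proof.
move=> z0; have a0 := lt_trans ltr01 alpha_gt1.
have zw x : 0 < z + w x by rewrite ltr_pwDl.
have mzw : measurable_fun setT (fun x => (z + w x)^-1).
  by apply: measurable_fun_inv_ge0 => [|x]; [exact: measurable_funD|exact: ltW].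
have Iinv : (\int[P]_x (z / (z + w x))%:E = z%:E * tilted_expint alpha z)%E.
  rewrite -integral_tail ?ltW// -ge0_integralZl ?lee_fin ?ltW//.
  - by apply: eq_integral => x _; rewrite /exp_tail integral_exp_tail.
  - by move=> x _; exact: integral_ge0.
have rec := tilted_expint_rec a0 (ltW z0).
have I1 : (\int[P]_x (z / (z + w x))%:E + \int[P]_x (w x / (z + w x))%:E = 1)%E.
  rewrite -ge0_integralD//.
  - transitivity (\int[P]_x (cst 1%E x))%E.
      by apply: eq_integral => x _; rewrite -EFinD -mulrDl divff ?gt_eqF.
    by rewrite integral_cst// mul1e; exact: probability_setT.
  - by move=> x _; rewrite lee_fin divr_ge0 ?ltW.
  - by apply/measurable_EFinP; exact: measurable_funM.
  - by move=> x _; rewrite lee_fin divr_ge0 ?w_ge0// ltW.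
  - by apply/measurable_EFinP; exact: measurable_funM.
have fJ : (z%:E * tilted_expint alpha z)%E \is a fin_num.
  by rewrite fin_numM ?tilted_expint_fin// ltW.
rewrite EFinM scaled_expintE ?(ltW z0) ?ltrDr ?a0//.
rewrite fineK ?tilted_expint_fin ?ltrDr ?(ltW z0)//.
(* Extended reals cancel only finite terms: the finite quantity [fJ] is added to both sides before
   comparing. *)
rewrite -[LHS](addeK _ fJ) -[RHS](addeK _ fJ); congr (_ - _)%E.
by rewrite [RHS]addeC rec -I1 addeC Iinv.
Qed.

End gamma_law.

(** * Closed forms of the plain and corrected filters *)

Section filter_closed_forms.
Context {R : realType}.
Implicit Types (m y : nat -> R) (r x p v t : R) (i : nat).

Lemma truthE m x i : truth m x i = Mprod m i * x.
Proof.
elim: i => [|i IH] /=; first by rewrite /Mprod big_geq// mul1r.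
by rewrite IH /Mprod big_nat_recr//=; ring.
Qed.

Lemma MprodS m i : Mprod m i.+1 = Mprod m i * m i.
Proof. by rewrite /Mprod big_nat_recr. Qed.

Lemma SsumS m i : Ssum m i.+1 = Ssum m i + Mprod m i.+1 ^+ 2.
Proof. by rewrite /Ssum big_nat_recr. Qed.

Lemma BsumS m y i : Bsum m y i.+1 = Bsum m y i + Mprod m i.+1 * y i.+1.
Proof. by rewrite /Bsum big_nat_recr. Qed.

Lemma Ssum0 m : Ssum m 0 = 1.
Proof. by rewrite /Ssum big_nat1 /Mprod big_geq// expr1n. Qed.

Lemma Ssum_ge1 m i : 1 <= Ssum m i.
Proof.
elim: i => [|i IH]; first by rewrite Ssum0.
by rewrite SsumS (le_trans IH)// lerDl sqr_ge0.
Qed.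

Lemma Ssum_gt0 m i : 0 < Ssum m i.
Proof. exact: lt_le_trans ltr01 (Ssum_ge1 m i). Qed.

Lemma sqr_Mprod_le m i : Mprod m i ^+ 2 <= Ssum m i.
Proof.
case: i => [|i]; first by rewrite Ssum0 /Mprod big_geq// expr1n.
by rewrite SsumS lerDr (le_trans ler01)// Ssum_ge1.
Qed.

Let den_gt0 m r p i : 0 < r -> 0 <= p -> 0 < r + Ssum m i * p.
Proof. by move=> r0 p0; rewrite ltr_pwDl// mulr_ge0// ltW// Ssum_gt0. Qed.

(** This is the Gaussian posterior of the initial state given y_0, ..., y_i, of precision 1 / p +
    S_i / r when p > 0, propagated by M_(i+1). Starting at index i + 1 avoids the empty sum that
    index 0 would require. *)
Lemma kf_forecastS m r y x p i : 0 < r -> 0 <= p ->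
  kf_forecast m r y x p i.+1 =
  (Mprod m i.+1 * (x * r + p * Bsum m y i) / (r + Ssum m i * p),
   Mprod m i.+1 ^+ 2 * p * r / (r + Ssum m i * p)).
Proof.
move=> r0 p0; have d0 := den_gt0 m _ r0 p0.
elim: i => [|i IH].
  have := d0 0%N; rewrite /= /propagate /analysis /gain /= MprodS Ssum0 mul1r => d00.
  rewrite /Bsum big_nat1 /Mprod big_geq// !mul1r.
  by congr pair; field; rewrite gt_eqF// addrC.
rewrite [LHS]/= -/(kf_forecast m r y x p i.+1) IH.
rewrite /propagate /analysis /gain /= (MprodS _ i.+1).
have := d0 i.+1; rewrite SsumS BsumS.
have r_neq0 := lt0r_neq0 r0.
move: (lt0r_neq0 (d0 i)) => di dSi; have {dSi} := lt0r_neq0 dSi.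
move: di; move: (Ssum m i) (Bsum m y i) (Mprod m i.+1) (m i.+1) (y i.+1).
move=> S B M mi yi d0' d1.
(* The gain is simplified first, so that [field] meets only the two denominators known to be
   nonzero. *)
have -> : M ^+ 2 * p * r / (r + S * p) / (M ^+ 2 * p * r / (r + S * p) + r) =
    M ^+ 2 * p / (r + (S + M ^+ 2) * p).
  have -> : M ^+ 2 * p * r / (r + S * p) + r =
      r * (r + (S + M ^+ 2) * p) / (r + S * p) by field.
  by field; rewrite d0' d1.
by congr pair; field; rewrite d0' d1.
Qed.

Lemma kf_analysis_meanE m r y x p i : 0 < r -> 0 <= p ->
  kf_analysis_mean m r y x p i =
  Mprod m i * (x * r + p * Bsum m y i) / (r + Ssum m i * p).
Proof.
move=> r0 p0; have d0 := den_gt0 m i r0 p0; move: d0; rewrite /kf_analysis_mean.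
have r_neq0 := lt0r_neq0 r0.
case: i => [|i].
  rewrite Ssum0 mul1r /analysis /gain /= /Bsum big_nat1 /Mprod big_geq// !mul1r => d0.
  by field; rewrite gt_eqF// addrC.
rewrite kf_forecastS// /analysis /gain /= SsumS BsumS => d1.
move: (lt0r_neq0 (den_gt0 m i r0 p0)) (lt0r_neq0 d1) => {d1}.
move: (Ssum m i) (Bsum m y i) (Mprod m i.+1) (y i.+1) => S B M yi d0 d1.
have -> : M ^+ 2 * p * r / (r + S * p) / (M ^+ 2 * p * r / (r + S * p) + r) =
    M ^+ 2 * p / (r + (S + M ^+ 2) * p).
  have -> : M ^+ 2 * p * r / (r + S * p) + r =
      r * (r + (S + M ^+ 2) * p) / (r + S * p) by field.
  by field; rewrite d0 d1.
by field; rewrite d0 d1.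
Qed.

(* Inflating by [opt_inflation] and shifting by [opt_correction] turns the
   forecast of the filter with initial variance [th i * v] into the one of the
   filter with initial variance [th i.+1 * v]. *)
Lemma corrected_forecastE (th : nat -> R) m r y x v i :
  0 < r -> 0 <= v -> (forall j, 0 < th j) ->
  corrected_forecast m r y x v (opt_inflation th m r v) (opt_correction th m r y x v) i
  = kf_forecast m r y x (th i * v) i.
Proof.
move=> r0 v0 th0; elim: i => [//|i IH].
have thv j : 0 <= th j * v by rewrite mulr_ge0// ltW.
have -> phi psi : corrected_forecast m r y x v phi psi i.+1 =
  let f := propagate (m i) (analysis r (y i) (corrected_forecast m r y x v phi psi i)) in
  (f.1 + psi i.+1, phi i.+1 * f.2) by [].
rewrite IH -[propagate _ _]/(kf_forecast m r y x (th i * v) i.+1) !kf_forecastS//=.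
have := lt0r_neq0 (den_gt0 m i r0 (thv i)); have := lt0r_neq0 (den_gt0 m i r0 (thv i.+1)).
have := lt0r_neq0 (th0 i); have := lt0r_neq0 (th0 i.+1); have r_neq0 := lt0r_neq0 r0.
move: (Ssum m i) (Bsum m y i) (Mprod m i.+1) (th i) (th i.+1) => S B M t t' t'0 t0 d' d.
have e' : S * t' * v + r = r + S * (t' * v) by ring.
have e : S * t * v + r = r + S * (t * v) by ring.
rewrite e e'.
congr pair; field; rewrite ?d ?d' ?t0//.
Qed.

Lemma corrected_analysis_meanE (th : nat -> R) m r y x v i :
  0 < r -> 0 <= v -> (forall j, 0 < th j) ->
  corrected_analysis_mean m r y x v (opt_inflation th m r v) (opt_correction th m r y x v) i
  = kf_analysis_mean m r y x (th i * v) i.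
Proof. by move=> r0 v0 th0; rewrite /corrected_analysis_mean corrected_forecastE. Qed.

(** Splitting off M_i B_i / S_i, the limit as p grows, leaves [p] in the single factor 1 / (r + S_i
    p). Averaging over a random initial variance then reduces to moments of that factor. *)
Lemma kf_analysis_meanB m r y x p i : 0 < r -> 0 <= p ->
  kf_analysis_mean m r y x p i =
  Mprod m i * (Bsum m y i / Ssum m i)
  + Mprod m i * r * (x - Bsum m y i / Ssum m i) * (r + Ssum m i * p)^-1.
Proof.
move=> r0 p0; rewrite kf_analysis_meanE//.
by field; rewrite !lt0r_neq0 ?Ssum_gt0 ?den_gt0.
Qed.

End filter_closed_forms.

Lemma expectationE d (T : measurableType d) (R : realType) (P : probability T R)
  (X : T -> R) : ('E_P[X] = \int[P]_w (X w)%:E)%E.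
Proof. by rewrite unlock. Qed.

(** * Moments of weighted sums of independent normal variables *)

Section gaussian_sums.
Context d (T : measurableType d) (R : realType) (P : probability T R).
Context (I : eqType) (X : I -> {RV P >-> R}) (mean : I -> R) (var : R).
Hypotheses (var_gt0 : 0 < var) (X_law : independent_normal X mean var).

Lemma normal_sum_mgf (J : seq I) (c : I -> R) : uniq J ->
  (\int[P]_w (expR (\sum_(i <- J) c i * (X i w - mean i)))%:E =
   (expR ((\sum_(i <- J) c i ^+ 2) * var / 2))%:E)%E.
Proof.
move=> uJ; case: X_law => dX indep.
have E : ('E_P[(fun w => \prod_(i <- J) expR (c i * (X i w - mean i)))%R] =
    (\prod_(i <- J) expR (c i ^+ 2 * var / 2))%:E)%E.
  apply: (independent_expectation_prod (f := fun i x => expR (c i * (x - mean i)))).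
  - by [].
  - by [].
  - move=> i; apply: measurableT_comp => //; apply: measurable_funM => //.
    exact: measurable_funB.
  - by move=> i x; exact: expR_ge0.
  - move=> i; exact: (normal_mgf_center (c i) var_gt0 (dX i)).
rewrite 2!mulr_suml [in RHS]expR_sum -E expectationE.
by apply: eq_integral => w _; rewrite expR_sum.
Qed.

(** The pointwise bound x^2 / 2 <= e^x + e^(-x) keeps every integrand nonnegative, as the product
    formula for independent variables requires. With [t] the reciprocal of the standard deviation of
    the sum, both exponential moments are e^(1/2), whence the constant 4 e^(1/2). *)
Lemma normal_sum_sqr_le (J : seq I) (c : I -> R) : uniq J ->
  0 < \sum_(i <- J) c i ^+ 2 ->
  (\int[P]_w ((\sum_(i <- J) c i * (X i w - mean i)) ^+ 2)%:E <=
   (4 * expR 2^-1 * var * \sum_(i <- J) c i ^+ 2)%:E)%E.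
Proof.
move=> uJ; set s := \sum_(i <- J) c i ^+ 2 => s0.
have vs0 : 0 < var * s by rewrite mulr_gt0.
pose t := (Num.sqrt (var * s))^-1.
have t2 : t ^+ 2 = (var * s)^-1 by rewrite exprVn sqr_sqrtr// ltW.
pose W w := \sum_(i <- J) c i * (X i w - mean i).
have mW : measurable_fun setT W.
  apply: measurable_sum => i; apply: measurable_funM => //.
  exact: measurable_funB.
have mgf u : u ^+ 2 = t ^+ 2 -> (\int[P]_w (expR (u * W w))%:E = (expR 2^-1)%:E)%E.
  move=> ut; have := normal_sum_mgf (fun i => u * c i) uJ.
  under eq_bigr do rewrite exprMn.
  rewrite -mulr_sumr ut t2 -/s (_ : _ / 2 = 2^-1); last first.
    by field; rewrite !gt_eqF.
  move=> <-; apply: eq_integral => w _; rewrite /W mulr_sumr.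
  by congr (expR _)%:E; apply: eq_bigr => i _; rewrite mulrA.
have meW u : measurable_fun setT (fun w => (expR (u * W w))%:E).
  by apply/measurable_EFinP; apply: measurableT_comp => //; exact: measurable_funM.
apply: (@le_trans _ _ (\int[P]_w ((2 * (var * s))%:E *
    ((expR (t * W w))%:E + (expR (- t * W w))%:E)))%E).
  apply: ge0_le_integral => //.
  - by move=> w _; rewrite lee_fin sqr_ge0.
  - by apply/measurable_EFinP; exact: measurable_funX.
  - apply: measurable_funeM; exact: emeasurable_funD.
  - move=> w _; rewrite -EFinD -EFinM lee_fin -/(W w).
    have -> : W w ^+ 2 = 2 * (var * s) * ((t * W w) ^+ 2 / 2).
      by rewrite exprMn t2; field; rewrite !gt_eqF.
    rewrite ler_wpM2l ?mulr_ge0 ?(ltW var_gt0) ?(ltW s0)//.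
    rewrite mulNr; move: (t * W w) => x.
    have key (y : R) : 0 <= y -> y ^+ 2 / 2 <= expR y.
      move=> y0; apply: le_trans (expR_ge1Dxn 1 y0).
      by rewrite lerDr.
    have [x0|/ltW x0] := leP 0 x.
      by rewrite (le_trans (key _ x0))// lerDl expR_ge0.
    rewrite -oppr_ge0 in x0.
    by rewrite -sqrrN (le_trans (key _ x0))// lerDr expR_ge0.
have e0 u w : (0 <= (expR (u * W w))%:E)%E by rewrite lee_fin expR_ge0.
rewrite ge0_integralZl ?lee_fin ?mulr_ge0 ?(ltW var_gt0) ?(ltW s0)//; first last.
- by move=> w _; exact: adde_ge0.
- exact: emeasurable_funD.
rewrite ge0_integralD// mgf// mgf ?sqrrN// -EFinD -EFinM lee_fin.
by rewrite le_eqVlt; apply/orP; left; apply/eqP; ring.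
Qed.

End gaussian_sums.

(** The rescaled sample variance is the sum of a_j^2 / (2 var); each of the N = 2 alpha anomalies
    contributes (1 + l)^(-1/2). *)
Lemma sample_variance_laplace d (T : measurableType d) (R : realType)
    (P : probability T R) (N : nat) (a : 'I_N -> {RV P >-> R}) (alpha var l : R) :
  0 < alpha -> N%:R = 2 * alpha -> 0 < var ->
  independent_normal a (fun=> 0) var -> 0 <= l ->
  (\int[P]_x (expR (- (l * (alpha / var * sample_variance a x))))%:E =
   ((1 + l) `^ (- alpha))%:E)%E.
Proof.
move=> alpha0 NE var0 [da indep] l0.
have N0 : N%:R != 0 :> R by rewrite NE mulf_neq0// gt_eqF.
have E : ('E_P[(fun x => \prod_(j < N) expR (- l * (a j x ^+ 2 / (2 * var))))%R] =
    (\prod_(j < N) (1 + l) `^ (- 2^-1))%:E)%E.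
  apply: (independent_expectation_prod (f := fun _ x => expR (- l * (x ^+ 2 / (2 * var))))).
  - by [].
  - exact: index_enum_uniq.
  - move=> i; apply: measurableT_comp => //; apply: measurable_funM => //.
    by apply: measurable_funM => //; exact: measurable_funX.
  - by move=> i x; exact: expR_ge0.
  - by move=> i; exact: (normal_laplace_sqr var0 l0 (da i)).
have -> : (1 + l) `^ (- alpha) = \prod_(j < N) (1 + l) `^ (- 2^-1).
  rewrite prodr_const card_ord -powR_mulrn ?powR_ge0// -powRrM NE.
  by congr (_ `^ _); field.
rewrite -E expectationE; apply: eq_integral => x _; rewrite -expR_sum -mulr_sumr.
congr (expR _)%:E; rewrite /sample_variance -mulr_suml.
have -> : alpha = N%:R / 2 by rewrite NE; field.
by field; rewrite N0 gt_eqF.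
Qed.

(** * Criteria for convergence to zero, deterministic and random *)

Lemma bounded_nnseries_cvg0 (R : realType) (u : nat -> R) (B : R) :
  (forall i, 0 <= u i) -> (forall n, \sum_(0 <= i < n) u i <= B) ->
  u i @[i --> \oo] --> 0.
Proof.
move=> u0 uB; apply: (@cvg_series_cvg_0 _ R^o).
apply: nondecreasing_is_cvgn.
  by apply/nondecreasing_seqP => n; rewrite /series /= big_nat_recr//= lerDl.
by exists B => _ [n _ <-]; exact: uB.
Qed.

Lemma cvg0_sqr (R : realType) (u : nat -> R) :
  u i ^+ 2 @[i --> \oo] --> 0 -> u i @[i --> \oo] --> 0.
Proof.
move=> /cvgrPdist_lt H; apply/cvgrPdist_lt => e e0.
have := H (e ^+ 2) (exprn_gt0 2 e0); apply: filterS => i.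
rewrite !sub0r !normrN normrX ltr_pXn2r// nnegrE//; exact: ltW.
Qed.

Lemma cvg0Ml (R : realType) (u : nat -> R) (C : R) :
  u i @[i --> \oo] --> 0 -> u i * C @[i --> \oo] --> 0.
Proof. by move=> u0; rewrite -(mul0r C); exact: cvgMl. Qed.

Lemma le_cvg0 (R : realType) (u v : nat -> R) :
  (forall i, `|u i| <= v i) -> v i @[i --> \oo] --> 0 -> u i @[i --> \oo] --> 0.
Proof.
move=> uv v0; apply: norm_cvg0; apply: (@squeeze_cvgr _ _ _ _ (cst 0) v) => //.
- by apply: nearW => i; rewrite normr_ge0 uv.
- exact: cvg_cst.
Qed.

Lemma integral_cst_probability d (T : measurableType d) (R : realType)
  (P : probability T R) (c : R) : (\int[P]_x c%:E = c%:E)%E.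
Proof.
rewrite integral_cst// -[RHS]mule1; congr (_ * _)%E; exact: probability_setT.
Qed.

Section convergence.
Context d (T : measurableType d) (R : realType) (P : probability T R).

(** The random series has expectation at most [B], hence converges almost everywhere, and its terms
    vanish in the limit. *)
Lemma ae_cvg0_of_bounded_series (Y : nat -> T -> R) (q : nat -> R) (B : R) :
  (forall i, measurable_fun setT (Y i)) -> (forall i w, 0 <= Y i w) ->
  (forall i, (\int[P]_w (Y i w)%:E <= (q i)%:E)%E) ->
  (forall n, \sum_(0 <= i < n) q i <= B) ->
  {ae P, forall w, Y i w @[i --> \oo] --> 0}.
Proof.
move=> mY Y0 Yq qB.
have mYE i : measurable_fun setT (EFin \o Y i) by exact/measurable_EFinP.
have intS : (\int[P]_w (\sum_(i <oo) (Y i w)%:E) <= B%:E)%E.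
  rewrite integral_nneseries//; last by move=> i w _; rewrite lee_fin.
  apply: lime_le.
    apply: is_cvg_nneseries => i _ _.
    by apply: integral_ge0 => w _; rewrite lee_fin.
  apply: nearW => n; apply: (@le_trans _ _ (\sum_(0 <= i < n) (q i)%:E)%E).
    exact: lee_sum.
  by rewrite sumEFin lee_fin.
have S0 w : (0 <= \sum_(i <oo) (Y i w)%:E)%E.
  by apply: nneseries_ge0 => i _ _; rewrite lee_fin.
have : P.-integrable setT (fun w => \sum_(i <oo) (Y i w)%:E)%E.
  apply/integrableP; split.
    apply: ge0_emeasurable_sum; last by move=> k _; exact: mYE.
    by move=> k x _ _; rewrite lee_fin.
  rewrite (eq_integral _ _ (fun x _ => gee0_abs (S0 x))).
  exact: le_lt_trans intS (ltry _).
move=> /integrable_ae => /(_ measurableT); apply: filterS => w /(_ Logic.I) fw.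
apply: (@bounded_nnseries_cvg0 _ _ (fine (\sum_(i <oo) (Y i w)%:E)%E)) => // n.
rewrite -lee_fin fineK// -sumEFin.
by apply: nneseries_lim_ge => i _ _; rewrite lee_fin.
Qed.

(** Markov's inequality, applied to the dominating variable [u i + v i * W i w ^+ 2]. *)
Lemma cvg0_in_probability_of_sqr_bound (W : nat -> T -> R) (X : nat -> T -> R)
    (u v s : nat -> R) :
  (forall i, measurable_fun setT (W i)) -> (forall i, measurable_fun setT (X i)) ->
  (forall i, 0 <= u i) -> (forall i, 0 <= v i) ->
  (forall i w, `|X i w| <= u i + v i * W i w ^+ 2) ->
  (forall i, (\int[P]_w (W i w ^+ 2)%:E <= (s i)%:E)%E) ->
  u i + v i * s i @[i --> \oo] --> 0 ->
  cvg0_in_probability P (fun i w => (X i w)%:E).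
Proof.
move=> mW mX u0 v0 Xuv Ws us0 eps eps0.
have mA i : measurable [set w | (eps%:E < `|(X i w)%:E|)%E].
  rewrite (_ : [set w | _] = (fun w => `|X i w|) @^-1` `]eps, +oo[).
    rewrite -[X in measurable X]setTI.
    by apply: (measurableT_comp _ (mX i)).
  by apply/seteqP; split=> w /=; rewrite in_itv/= andbT lte_fin.
have bound i : (P [set w | (eps%:E < `|(X i w)%:E|)%E] <=
    (eps^-1 * (u i + v i * s i))%:E)%E.
  have mi : measurable_fun setT (fun w => (u i + v i * W i w ^+ 2)%:E).
    apply/measurable_EFinP; apply: measurable_funD => //.
    by apply: measurable_funM => //; exact: measurable_funX.
  have b0 w : (0 <= (u i + v i * W i w ^+ 2)%:E)%E.
    by rewrite lee_fin addr_ge0// mulr_ge0// sqr_ge0.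
  rewrite -[X in (X <= _)%E]mul1e -[in X in (X <= _)%E](mulVf (lt0r_neq0 eps0)).
  rewrite !EFinM -muleA lee_wpmul2l ?lee_fin ?invr_ge0 ?(ltW eps0)//.
  rewrite -[P _]mul1e.
  apply: (@le_trans _ _ (\int[P]_w (u i + v i * W i w ^+ 2)%:E)%E).
    rewrite mul1e -integral_cst//.
    apply: (@le_trans _ _ (\int[P]_(w in [set w | (eps%:E < `|(X i w)%:E|)%E])
        (u i + v i * W i w ^+ 2)%:E)%E); last first.
      by apply: ge0_subset_integral => // w _; exact: b0.
    apply: ge0_le_integral => //.
    - by move=> w _; rewrite lee_fin ltW.
    - exact: measurable_funTS.
    - by move=> w /=; rewrite lte_fin => /ltW h; rewrite lee_fin (le_trans h)//.
  under eq_integral do rewrite EFinD EFinM.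
  rewrite ge0_integralD//.
  - rewrite integral_cst_probability EFinD EFinM leeD2l//.
    rewrite ge0_integralZl ?lee_fin//.
    + by rewrite lee_wpmul2l ?lee_fin.
    + by apply/measurable_EFinP; exact: measurable_funX.
    + by move=> w _; rewrite lee_fin sqr_ge0.
  - by move=> w _; rewrite lee_fin.
  - by move=> w _; rewrite -EFinM lee_fin mulr_ge0// sqr_ge0.
  - apply/measurable_EFinP; apply: measurable_funM => //; exact: measurable_funX.
apply: (@squeeze_cvge _ _ _ _ (cst 0%E) _ (fun i => (eps^-1 * (u i + v i * s i))%:E)).
- by apply: nearW => i; rewrite measure_ge0 bound.
- exact: cvg_cst.
- apply: cvg_EFin; first exact: nearW.
  by rewrite -(mulr0 eps^-1); apply: cvgMr.
Qed.

(** It turns an expectation over the ensemble into a polynomial in [a] and [b], the coefficients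
    that will carry the observations. *)
Lemma bounded_rv_moments (rho : T -> R) (B : R) :
  measurable_fun setT rho -> (forall x, 0 <= rho x <= B) ->
  exists e1 e2 : R,
    [/\ (\int[P]_x (rho x)%:E = e1%:E)%E, (\int[P]_x (rho x ^+ 2)%:E = e2%:E)%E,
     forall a b, (\int[P]_x (a * rho x + b)%:E = (a * e1 + b)%:E)%E &
     forall a b, (\int[P]_x ((a * rho x + b) ^+ 2)%:E =
       (a ^+ 2 * e2 + 2 * a * b * e1 + b ^+ 2)%:E)%E].
Proof.
move=> mrho rhoB.
have ib (f : T -> R) (C : R) : measurable_fun setT f -> (forall x, `|f x| <= C) ->
    P.-integrable setT (EFin \o f).
  move=> mf fC; apply: measurable_bounded_integrable => //.
    exact: fin_num_fun_lty.
  by exists C; split; rewrite ?num_real// => D CD x _ /=; rewrite (le_trans (fC x))// ltW.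
have i1 : P.-integrable setT (EFin \o rho).
  by apply: (ib _ B) => // x; have /andP[? ?] := rhoB x; rewrite ger0_norm.
have i2 : P.-integrable setT (EFin \o (fun x => rho x ^+ 2)).
  apply: (ib _ (B ^+ 2)) => [|x]; first exact: measurable_funX.
  have /andP[r0 rB] := rhoB x.
  by rewrite ger0_norm ?sqr_ge0// lerXn2r// nnegrE// (le_trans r0).
have ic (c : R) : P.-integrable setT (EFin \o cst c).
  exact: finite_measure_integrable_cst.
have E1 := fineK (integrable_fin_num measurableT i1).
have E2 := fineK (integrable_fin_num measurableT i2).
set e1 := fine _ in E1; set e2 := fine _ in E2.
have Ec (c : R) : (\int[P]_x (EFin \o cst c) x = c%:E)%E.
  by rewrite integral_cst_probability.
exists e1, e2; split => //.
- move=> a b.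
  transitivity (\int[P]_x (a%:E * (rho x)%:E + (EFin \o cst b) x))%E.
    by apply: eq_integral => x _; rewrite EFinD EFinM.
  by rewrite integralD//; [rewrite integralZl// -E1 Ec EFinD EFinM | exact: integrableZl].
- move=> a b.
  transitivity (\int[P]_x ((a ^+ 2)%R%:E * (rho x ^+ 2)%R%:E +
      ((2 * a * b)%R%:E * (rho x)%:E + (EFin \o cst (b ^+ 2)%R) x)))%E.
    apply: eq_integral => x _; rewrite -!EFinM -!EFinD; congr (_%:E).
    by rewrite /=; ring.
  have i1' := integrableZl measurableT (2 * a * b) i1.
  have i2' := integrableZl measurableT (a ^+ 2) i2.
  rewrite integralD//; last exact: integrableD.
  rewrite integralD// !integralZl// -E1 -E2 Ec -!EFinM -!EFinD; congr (_%:E).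
  by ring.
Qed.

End convergence.

(** * Step limit of the model sums and of the averaged inverse denominators *)

Section asymptotics.
Context {R : realType} (m : nat -> R).

(* [M_i^2 / S_i^2 <= 1 / S_(i-1) - 1 / S_i] telescopes. *)
Lemma sum_sqr_Mprod_div_Ssum n :
  \sum_(0 <= i < n) (Mprod m i / Ssum m i) ^+ 2 <= 2.
Proof.
(* The telescoped remainder 1 / S_k is kept in the bound so that the induction closes; at k = 0 it
   reads 1 <= 2 - 1. *)
suff H k : \sum_(0 <= i < k.+1) (Mprod m i / Ssum m i) ^+ 2 <= 2 - (Ssum m k)^-1.
  case: n => [|n]; first by rewrite big_geq.
  by rewrite (le_trans (H n))// gerBl invr_ge0 ltW// Ssum_gt0.
elim: k => [|k IH].
  rewrite big_nat1 Ssum0 /Mprod big_geq// divr1 expr1n invr1.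
  by rewrite lerBrDr -natr1.
rewrite big_nat_recr//= (le_trans (lerD IH (lexx _)))//.
have := Ssum_gt0 m k; have := Ssum_gt0 m k.+1; rewrite SsumS.
set S := Ssum m k; set M := Mprod m k.+1 => S'0 S0.
rewrite -subr_ge0.
have -> : 2 - (S + M ^+ 2)^-1 - (2 - S^-1 + (M / (S + M ^+ 2)) ^+ 2) =
    (M ^+ 2) ^+ 2 / (S * (S + M ^+ 2) ^+ 2).
  by field; rewrite !gt_eqF.
by rewrite divr_ge0 ?sqr_ge0// mulr_ge0 ?sqr_ge0// ltW.
Qed.

Lemma Mprod_div_Ssum_cvg0 : Mprod m i / Ssum m i @[i --> \oo] --> 0.
Proof.
apply: cvg0_sqr; apply: (@bounded_nnseries_cvg0 _ _ 2) => [i|n].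
  exact: sqr_ge0.
exact: sum_sqr_Mprod_div_Ssum.
Qed.

Context d (T : measurableType d) (Q : probability T R) (v : T -> R) (r kappa : R).
Hypotheses (r_gt0 : 0 < r) (mv : measurable_fun setT v) (v_ge0 : forall x, 0 <= v x).
Hypothesis v_gt0 : {ae Q, forall x, 0 < v x}.
Hypothesis v_inv : (\int[Q]_x ((v x)^-1)%:E = kappa%:E)%E.

Let rho i x := (r + Ssum m i * v x)^-1.

Let den_gt0 i x : 0 < r + Ssum m i * v x.
Proof. by rewrite ltr_pwDl// mulr_ge0// ltW// Ssum_gt0. Qed.

Lemma measurable_inv_affine i : measurable_fun setT (rho i).
Proof.
apply: measurable_fun_inv_ge0 => [|x]; last exact: ltW.
by apply: measurable_funD => //; exact: measurable_funM.
Qed.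

Lemma inv_affine_bound i x : 0 <= rho i x <= r^-1.
Proof.
rewrite invr_ge0 (ltW (den_gt0 _ _)) /= lef_pV2 ?posrE//.
by rewrite lerDl mulr_ge0// ltW// Ssum_gt0.
Qed.

Let mvV : measurable_fun setT (fun x => (v x)^-1).
Proof. exact: measurable_fun_inv_ge0. Qed.

(** Dropping [r] from the denominator is legitimate only where [v] is positive, hence the
    almost-everywhere comparison. *)
Lemma integral_inv_affine_le i : (\int[Q]_x (rho i x)%:E <= (kappa / Ssum m i)%:E)%E.
Proof.
rewrite EFinM -v_inv -ge0_integralZr//; first last.
- by rewrite lee_fin invr_ge0 ltW// Ssum_gt0.
- by move=> x _; rewrite lee_fin invr_ge0.
- exact/measurable_EFinP.
apply: ae_ge0_le_integral => //.
- by move=> x _; rewrite lee_fin; have /andP[] := inv_affine_bound i x.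
- by apply/measurable_EFinP; exact: measurable_inv_affine.
- by move=> x _; rewrite mule_ge0 ?lee_fin ?invr_ge0// ltW// Ssum_gt0.
- by apply: emeasurable_funM => //; exact/measurable_EFinP.
- apply: filterS v_gt0 => x vx _; rewrite -EFinM lee_fin -invfM.
  by rewrite lef_pV2 ?posrE ?mulr_gt0 ?Ssum_gt0// mulrC lerDr ltW.
Qed.

(** Pointwise decay follows from |M_i rho_i| <= |M_i / S_i| / v, but integrating the square of this
    bound would take E(v^(-2)), while only E(v^(-1)) is controlled. Dominated convergence with the
    bound 1 / (r v) bridges the gap. *)
Lemma integral_sqr_inv_affine_cvg0 :
  (\int[Q]_x (Mprod m i ^+ 2 * rho i x ^+ 2)%:E)%E @[i --> \oo] --> 0%E.
Proof.
have mf i : measurable_fun setT (fun x => (Mprod m i ^+ 2 * rho i x ^+ 2)%:E).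
  apply/measurable_EFinP; apply: measurable_funM => //.
  by apply: measurable_funX; exact: measurable_inv_affine.
have ig : Q.-integrable setT (fun x => ((r^-1)%:E * ((v x)^-1)%:E)%E).
  apply: integrableZl => //; apply/integrableP; split; first exact/measurable_EFinP.
  under eq_integral do rewrite gee0_abs ?lee_fin ?invr_ge0//.
  by rewrite v_inv ltry.
have cv : {ae Q, forall x, setT x ->
    (Mprod m i ^+ 2 * rho i x ^+ 2)%:E @[i --> \oo] --> (cst 0%E x : \bar R)}.
  apply: filterS v_gt0 => x vx _ /=; apply: cvg_EFin; first exact: nearW.
  under eq_fun do rewrite -exprMn.
  suff : (Mprod m i * rho i x) ^+ 2 @[i --> \oo] --> (0 : R) ^+ 2 by rewrite expr0n.
  apply: (@cvg_comp _ _ _ _ (fun x => x ^+ 2)); last first.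
    exact: exprn_continuous.
  apply: (@le_cvg0 _ _ (fun i => `|Mprod m i / Ssum m i| * (v x)^-1)) => [i|].
    have S0 := Ssum_gt0 m i; have D0 := den_gt0 i x.
    rewrite !normrM -mulrA ler_wpM2l//.
    rewrite /rho ![`|_^-1|]ger0_norm ?invr_ge0 ?(ltW S0) ?(ltW D0)// -invfM.
    by rewrite lef_pV2 ?posrE ?mulr_gt0// lerDr ltW.
  rewrite -(mul0r (v x)^-1); apply: cvgMl.
  by rewrite -(normr0 R); apply: cvg_norm; exact: Mprod_div_Ssum_cvg0.
have dom : {ae Q, forall x n, setT x ->
    (`|(Mprod m n ^+ 2 * rho n x ^+ 2)%:E| <= (r^-1)%:E * ((v x)^-1)%:E)%E}.
  apply: filterS v_gt0 => x vx n _.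
  have S0 := Ssum_gt0 m n; have D0 := den_gt0 n x.
  have f0 : 0 <= Mprod m n ^+ 2 * rho n x ^+ 2 by rewrite mulr_ge0 ?sqr_ge0.
  rewrite gee0_abs ?lee_fin//.
  have -> : Mprod m n ^+ 2 * rho n x ^+ 2 = rho n x * (Mprod m n ^+ 2 * rho n x) by ring.
  have /andP[rho0 rhor] := inv_affine_bound n x.
  apply: ler_pM => //; first exact: mulr_ge0 (sqr_ge0 _) rho0.
  rewrite /rho ler_pdivrMr// ler_pdivlMl//.
  by rewrite mulrC (le_trans (ler_wpM2r (v_ge0 x) (sqr_Mprod_le m n)))// lerDr ltW.
have [_ _] := dominated_convergence measurableT mf (measurable_cst 0%E) cv ig dom.
by rewrite integral0.
Qed.

End asymptotics.

(** * Convergence of the moments of the discrepancy, as functions of the observations *)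

Section discrepancy.
Context {R : realType} (m : nat -> R) (r : R) (r_gt0 : 0 < r).

(** Choice collects the moments at each step into two real sequences; through them alone the
    ensemble enters the arguments about the observations. *)
Lemma inv_affine_moments d (T : measurableType d) (Q : probability T R) (v : T -> R)
    (kappa : R) :
  measurable_fun setT v -> (forall x, 0 <= v x) -> {ae Q, forall x, 0 < v x} ->
  (\int[Q]_x ((v x)^-1)%:E = kappa%:E)%E ->
  exists e1 e2 : nat -> R,
  [/\ forall i, 0 <= e1 i <= kappa / Ssum m i,
      forall i, 0 <= e2 i,
      Mprod m i ^+ 2 * e2 i @[i --> \oo] --> 0,
      forall i a b, (\int[Q]_x (a * (r + Ssum m i * v x)^-1 + b)%:E = (a * e1 i + b)%:E)%E &
      forall i a b, (\int[Q]_x ((a * (r + Ssum m i * v x)^-1 + b) ^+ 2)%:E =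
        (a ^+ 2 * e2 i + 2 * a * b * e1 i + b ^+ 2)%:E)%E].
Proof.
move=> mv v0 vgt0 vinv.
have mom i : exists e : R * R,
    [/\ (\int[Q]_x ((r + Ssum m i * v x)^-1)%:E = e.1%:E)%E,
     (\int[Q]_x ((r + Ssum m i * v x)^-1 ^+ 2)%:E = e.2%:E)%E,
     forall a b, (\int[Q]_x (a * (r + Ssum m i * v x)^-1 + b)%:E = (a * e.1 + b)%:E)%E &
     forall a b, (\int[Q]_x ((a * (r + Ssum m i * v x)^-1 + b) ^+ 2)%:E =
       (a ^+ 2 * e.2 + 2 * a * b * e.1 + b ^+ 2)%:E)%E].
  have [e1 [e2 He]] := bounded_rv_moments Q (measurable_inv_affine m r_gt0 mv v0 i)
    (inv_affine_bound m r_gt0 v0 i).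
  by exists (e1, e2).
have [e He] := choice mom.
exists (fun i => (e i).1), (fun i => (e i).2); split.
- move=> i; have [E1 _ _ _] := He i; apply/andP; split.
    rewrite -lee_fin -E1; apply: integral_ge0 => x _; rewrite lee_fin.
    by have /andP[] := inv_affine_bound m r_gt0 v0 i x.
  by rewrite -lee_fin -E1; exact: integral_inv_affine_le.
- move=> i; have [_ E2 _ _] := He i.
  by rewrite -lee_fin -E2; apply: integral_ge0 => x _; rewrite lee_fin sqr_ge0.
- have := integral_sqr_inv_affine_cvg0 m r_gt0 mv v0 vgt0 vinv.
  under eq_fun => i.
    under eq_integral do rewrite EFinM.
    rewrite ge0_integralZl ?lee_fin ?sqr_ge0//; first last.
    - by move=> x _; rewrite lee_fin sqr_ge0.
    - apply/measurable_EFinP; apply: measurable_funX; exact: measurable_inv_affine.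
    have [_ -> _ _] := He i; rewrite -EFinM; over.
  by move/fine_cvg.
- by move=> i; have [_ _ H _] := He i.
- by move=> i; have [_ _ _ H] := He i.
Qed.

Context d (T : measurableType d) (P : probability T R).
Context (y : nat -> {RV P >-> R}) (xtrue : R).
Hypothesis y_law : independent_normal y (truth m xtrue) r.

Definition noise i w : R := \sum_(0 <= l < i.+1) Mprod m l * (y l w - truth m xtrue l).

Lemma measurable_noise i : measurable_fun setT (noise i).
Proof.
apply: measurable_sum => l; apply: measurable_funM => //.
exact: measurable_funB.
Qed.

Lemma noise_second_moment i :
  (\int[P]_w (noise i w ^+ 2)%:E <= (4 * expR 2^-1 * r * Ssum m i)%:E)%E.
Proof.
apply: (normal_sum_sqr_le r_gt0 y_law); first exact: iota_uniq.
exact: Ssum_gt0.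
Qed.

Lemma Bsum_noise i w : Bsum m (fun j => y j w) i = Ssum m i * xtrue + noise i w.
Proof.
rewrite /Bsum /noise /Ssum mulr_suml -big_split /=; apply: eq_bigr => l _.
by rewrite truthE; ring.
Qed.

Variables (xt x0 p0 : R).
Hypothesis p0_gt0 : 0 < p0.

Let W := noise.
Let b := xt - xtrue.
Let b0 := x0 - xtrue.
Let rho0 i := (r + Ssum m i * p0)^-1.

Lemma discrepancyE i w p : 0 <= p ->
  kf_analysis_mean m r (fun j => y j w) xt p i -
  kf_analysis_mean m r (fun j => y j w) x0 p0 i
  = Mprod m i * r * (b - W i w / Ssum m i) * (r + Ssum m i * p)^-1
    + - (Mprod m i * r * (b0 - W i w / Ssum m i) * rho0 i).
Proof.
move=> p_ge0; rewrite !kf_analysis_meanB ?(ltW p0_gt0)// Bsum_noise.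
rewrite mulrDl mulrAC divff ?gt_eqF ?Ssum_gt0// mul1r /b /b0 /rho0 /W.
by ring.
Qed.

Let rho0_ge0 i : 0 <= rho0 i.
Proof. by rewrite invr_ge0 addr_ge0 ?mulr_ge0// ltW// Ssum_gt0. Qed.

Let rho0_le i : rho0 i <= p0^-1 / Ssum m i.
Proof.
have S0 := Ssum_gt0 m i.
by rewrite -invfM lef_pV2 ?posrE ?addr_gt0 ?mulr_gt0// mulrC lerDr ltW.
Qed.

Variables (e1 e2 : nat -> R) (kappa : R).
Hypothesis e1_bound : forall i, 0 <= e1 i <= kappa / Ssum m i.
Hypothesis e2_ge0 : forall i, 0 <= e2 i.
Hypothesis e2_cvg0 : Mprod m i ^+ 2 * e2 i @[i --> \oo] --> 0.

(** The mean discrepancy is the deterministic part [c i] plus [dd i] times the noise. With [a i]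
    tending to 0, [c i] is O(a_i) and [dd i] is O(a_i / S_i), which compensates the second moment
    O(S_i) of the noise. *)
Let c i := Mprod m i * r * (b * e1 i - b0 * rho0 i).
Let dd i := - (Mprod m i / Ssum m i * r * (e1 i - rho0 i)).
Let a i := `|Mprod m i / Ssum m i|.
Let k := kappa + p0^-1.

Let a_ge0 i : 0 <= a i. Proof. exact: normr_ge0. Qed.

Let a_cvg0 : a i @[i --> \oo] --> 0.
Proof. by rewrite -(normr0 R); apply: cvg_norm; exact: Mprod_div_Ssum_cvg0. Qed.

Let normM i : `|Mprod m i| = a i * Ssum m i.
Proof.
by rewrite /a normrM [`|_^-1|]gtr0_norm ?invr_gt0 ?Ssum_gt0// divfK// gt_eqF// Ssum_gt0.
Qed.

Let c_le i : `|c i| <= a i * (r * (`|b| * kappa + `|b0| / p0)).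
Proof.
have S0 := Ssum_gt0 m i; have /andP[e1ge e1le] := e1_bound i.
have H : `|b * e1 i - b0 * rho0 i| <= (`|b| * kappa + `|b0| / p0) / Ssum m i.
  rewrite (le_trans (ler_normB _ _))// !normrM (ger0_norm e1ge) (ger0_norm (rho0_ge0 i)).
  by rewrite mulrDl -!mulrA lerD// ler_wpM2l.
rewrite /c !normrM normM (gtr0_norm r_gt0).
have -> : a i * (r * (`|b| * kappa + `|b0| / p0)) =
    a i * Ssum m i * r * ((`|b| * kappa + `|b0| / p0) / Ssum m i).
  by field; rewrite !gt_eqF.
by rewrite ler_wpM2l// !mulr_ge0 ?normr_ge0// ltW.
Qed.

Let d_le i : `|dd i| <= a i * (r * k) / Ssum m i.
Proof.
have S0 := Ssum_gt0 m i; have /andP[e1ge e1le] := e1_bound i.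
have H : `|e1 i - rho0 i| <= k / Ssum m i.
  rewrite (le_trans (ler_normB _ _))// (ger0_norm e1ge) (ger0_norm (rho0_ge0 i)).
  by rewrite mulrDl lerD.
rewrite /dd normrN !normrM -normrM (gtr0_norm r_gt0) -/(a i) -!mulrA.
by rewrite !ler_wpM2l ?normr_ge0// ltW.
Qed.

Let kappa_ge0 : 0 <= kappa.
Proof.
have /andP[h1 h2] := e1_bound 0%N.
by move: (le_trans h1 h2); rewrite Ssum0 divr1.
Qed.

Let k_ge0 : 0 <= k.
Proof. by rewrite addr_ge0// invr_ge0 ltW. Qed.

Let K := 4 * expR 2^-1 * r.

Let K_ge0 : 0 <= K.
Proof. by rewrite !mulr_ge0 ?expR_ge0// ltW. Qed.

Lemma mean_discrepancyE i w :
  Mprod m i * r * (b - W i w / Ssum m i) * e1 i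
    + - (Mprod m i * r * (b0 - W i w / Ssum m i) * rho0 i) = c i + dd i * W i w.
Proof. by rewrite /c /dd; ring. Qed.

(** As |W| <= 1 + W^2, the quantity to control is |c_i| + |dd_i| (1 + K S_i), which is O(a_i). *)
Lemma mean_discrepancy_cvg0_in_probability (X : nat -> T -> R) :
  (forall i w, X i w = c i + dd i * W i w) ->
  cvg0_in_probability P (fun i w => (X i w)%:E).
Proof.
move=> XE.
have aK i : `|(`|c i| + `|dd i|) + `|dd i| * (K * Ssum m i)| <=
    a i * (r * (`|b| * kappa + `|b0| / p0) + r * k + r * k * K).
  have S0 := Ssum_gt0 m i; have S1 := Ssum_ge1 m i.
  have rk0 : 0 <= a i * (r * k) by rewrite !mulr_ge0// (ltW r_gt0).
  have KS0 : 0 <= K * Ssum m i := mulr_ge0 K_ge0 (ltW S0).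
  have dKS0 : 0 <= `|dd i| * (K * Ssum m i) := mulr_ge0 (normr_ge0 _) KS0.
  rewrite ger0_norm; last by rewrite !addr_ge0.
  rewrite [leRHS]mulrDr [a i * (_ + r * k)]mulrDr; apply: lerD; first apply: lerD => //.
    apply: le_trans (d_le i) _.
    by rewrite ler_pdivrMr// ler_peMr.
  apply: (@le_trans _ _ (a i * (r * k) / Ssum m i * (K * Ssum m i))).
    by rewrite ler_wpM2r.
  by rewrite le_eqVlt; apply/orP; left; apply/eqP; field; rewrite gt_eqF.
refine (@cvg0_in_probability_of_sqr_bound _ _ _ P W X
  (fun i => `|c i| + `|dd i|) (fun i => `|dd i|)
  (fun i => K * Ssum m i) _ _ _ _ _ _ _) => //.
- exact: measurable_noise.
- move=> i; rewrite (_ : X i = fun w => c i + dd i * W i w); last exact/funext.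
  apply: measurable_funD => //; apply: measurable_funM => //; exact: measurable_noise.
- move=> i w; rewrite XE (le_trans (ler_normD _ _))// -addrA lerD2l.
  have -> : `|dd i| + `|dd i| * W i w ^+ 2 = `|dd i| * (1 + W i w ^+ 2) by ring.
  rewrite [leLHS]normrM ler_wpM2l//.
  have := sqr_ge0 (`|W i w| - 1); rewrite -(real_normK (num_real (W i w))).
  by have := normr_ge0 (W i w); nra.
- exact: noise_second_moment.
- by apply: (le_cvg0 aK); exact: cvg0Ml.
Qed.

Lemma mean_discrepancy_cvg0_almost_surely (X : nat -> T -> R) :
  (forall i w, X i w = c i + dd i * W i w) ->
  cvg0_almost_surely P (fun i w => (X i w)%:E).
Proof.
move=> XE; pose B := (r * k) ^+ 2 * K.
have B0 : 0 <= B by rewrite mulr_ge0// sqr_ge0.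
have c0 : c i @[i --> \oo] --> 0.
  by apply: (le_cvg0 c_le); exact: cvg0Ml.
have : {ae P, forall w, (dd i * W i w) ^+ 2 @[i --> \oo] --> 0}.
  apply: (@ae_cvg0_of_bounded_series _ _ _ _ _
      (fun i => (Mprod m i / Ssum m i) ^+ 2 * B) (2 * B)) => [i|i w|i|n].
  - apply: measurable_funX; apply: measurable_funM => //; exact: measurable_noise.
  - exact: sqr_ge0.
  - have S0 := Ssum_gt0 m i; have S1 := Ssum_ge1 m i.
    under eq_integral do rewrite exprMn EFinM.
    rewrite ge0_integralZl ?lee_fin ?sqr_ge0//; first last.
    + by move=> w _; rewrite lee_fin sqr_ge0.
    + by apply/measurable_EFinP; apply: measurable_funX; exact: measurable_noise.
    apply: (@le_trans _ _ ((dd i ^+ 2)%:E * (K * Ssum m i)%:E)%E).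
      by rewrite lee_wpmul2l ?lee_fin ?sqr_ge0// noise_second_moment.
    rewrite -EFinM lee_fin.
    apply: (@le_trans _ _ ((a i * (r * k) / Ssum m i) ^+ 2 * (K * Ssum m i))).
      rewrite ler_wpM2r//; first exact: mulr_ge0 K_ge0 (ltW S0).
      rewrite -(real_normK (num_real (dd i))) lerXn2r ?nnegrE//.
      by rewrite divr_ge0 ?(ltW S0)// !mulr_ge0// ltW.
    have -> : (a i * (r * k) / Ssum m i) ^+ 2 * (K * Ssum m i) =
        (Mprod m i / Ssum m i) ^+ 2 * B / Ssum m i.
      rewrite -(real_normK (num_real (Mprod m i / Ssum m i))) -/(a i) /B.
      by field; rewrite gt_eqF.
    by rewrite ler_pdivrMr// ler_peMr// mulr_ge0 ?sqr_ge0.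
  - by rewrite -mulr_suml ler_wpM2r// sum_sqr_Mprod_div_Ssum.
apply: filterS => w /cvg0_sqr dW.
apply: cvg_EFin; first exact: nearW.
rewrite (_ : fine \o _ = fun i => c i + dd i * W i w); last first.
  by apply/funext => i /=; rewrite XE.
by rewrite -(addr0 0); exact: cvgD.
Qed.

Lemma sqr_discrepancy_cvg0_in_probability (X : nat -> T -> R) :
  (forall i w, X i w =
    let A := Mprod m i * r * (b - W i w / Ssum m i) in
    let B := - (Mprod m i * r * (b0 - W i w / Ssum m i) * rho0 i) in
    A ^+ 2 * e2 i + 2 * A * B * e1 i + B ^+ 2) ->
  (forall i u v, 0 <= u ^+ 2 * e2 i + 2 * u * v * e1 i + v ^+ 2) ->
  cvg0_in_probability P (fun i w => (X i w)%:E).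
Proof.
move=> XE quad.
pose z i := Mprod m i ^+ 2 * e2 i.
pose z0 i := Mprod m i ^+ 2 * rho0 i ^+ 2.
have z_ge0 i : 0 <= z i by rewrite mulr_ge0 ?sqr_ge0.
have z0_ge0 i : 0 <= z0 i by rewrite mulr_ge0 ?sqr_ge0.
have z0_cvg0 : z0 i @[i --> \oo] --> 0.
  apply: (@le_cvg0 _ _ (fun i => a i * a i * (p0^-1 ^+ 2))) => [i|].
    have S0 := Ssum_gt0 m i.
    rewrite ger0_norm// /z0 -(real_normK (num_real (Mprod m i))) normM.
    have -> : a i * a i * p0^-1 ^+ 2 = (a i * Ssum m i) ^+ 2 * (p0^-1 / Ssum m i) ^+ 2.
      by field; rewrite !gt_eqF.
    by rewrite ler_wpM2l ?sqr_ge0// lerXn2r ?nnegrE// divr_ge0 ?invr_ge0// ltW.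
  by apply: cvg0Ml; rewrite -(mul0r 0); exact: cvgM.
(* One factor 2 of the constant 4 comes from removing the cross term [A * B], the other from (s -
   t)^2 <= 2 s^2 + 2 t^2, which separates the bias from the noise. *)
pose u i := 4 * r ^+ 2 * (z i * b ^+ 2 + z0 i * b0 ^+ 2).
pose v i := 4 * r ^+ 2 * (z i + z0 i) / Ssum m i ^+ 2.
have r2 : 0 <= 4 * r ^+ 2 by rewrite mulr_ge0 ?sqr_ge0.
have u_ge0 i : 0 <= u i.
  by apply: mulr_ge0 => //; apply: addr_ge0; apply: mulr_ge0 => //; exact: sqr_ge0.
have zz0 i : 0 <= 4 * r ^+ 2 * (z i + z0 i) by apply: mulr_ge0 => //; exact: addr_ge0.
have v_ge0 i : 0 <= v i by apply: divr_ge0 => //; exact: sqr_ge0.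
refine (@cvg0_in_probability_of_sqr_bound _ _ _ P W X u v
  (fun i => K * Ssum m i) _ _ _ _ _ _ _) => //.
- exact: measurable_noise.
- move=> i; rewrite (_ : X i = fun w => let A := Mprod m i * r * (b - W i w / Ssum m i) in
    let B := - (Mprod m i * r * (b0 - W i w / Ssum m i) * rho0 i) in
    A ^+ 2 * e2 i + 2 * A * B * e1 i + B ^+ 2); last exact/funext.
  have mA (t : R) : measurable_fun setT (fun w => Mprod m i * r * (t - W i w / Ssum m i)).
    apply: measurable_funM => //; apply: measurable_funB => //.
    by apply: measurable_funM => //; exact: measurable_noise.
  have mB : measurable_fun setT
      (fun w => - (Mprod m i * r * (b0 - W i w / Ssum m i) * rho0 i)).
    by apply: measurable_funN; exact: measurable_funM.
  apply: measurable_funD; last exact: measurable_funX.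
  apply: measurable_funD; apply: measurable_funM => //; first exact: measurable_funX.
  by apply: measurable_funM => //; exact: measurable_funM.
- move=> i w; rewrite XE /=.
  set A := Mprod m i * r * _; set B := - _.
  rewrite ger0_norm//.
  apply: (@le_trans _ _ (2 * (A ^+ 2 * e2 i) + 2 * B ^+ 2)).
    (* Nonnegativity at (A, -B) bounds the cross term 2 A B e1 by A^2 e2 + B^2. *)
    by have := quad i A (- B); nra.
  have sq (s t : R) : (s - t) ^+ 2 <= 2 * s ^+ 2 + 2 * t ^+ 2.
    by have := sqr_ge0 (s + t); nra.
  have := sq b (W i w / Ssum m i); have := sq b0 (W i w / Ssum m i).
  move=> /(ler_wpM2l (mulr_ge0 (sqr_ge0 r) (z0_ge0 i))).
  move=> /[swap] /(ler_wpM2l (mulr_ge0 (sqr_ge0 r) (z_ge0 i))).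
  rewrite /u /v; have -> : A ^+ 2 * e2 i = r ^+ 2 * z i * (b - W i w / Ssum m i) ^+ 2.
    by rewrite /A /z; ring.
  have -> : B ^+ 2 = r ^+ 2 * z0 i * (b0 - W i w / Ssum m i) ^+ 2.
    by rewrite /B /z0; ring.
  have -> : 4 * r ^+ 2 * (z i + z0 i) / Ssum m i ^+ 2 * W i w ^+ 2 =
      4 * r ^+ 2 * (z i + z0 i) * (W i w / Ssum m i) ^+ 2.
    by field; rewrite gt_eqF// Ssum_gt0.
  by lra.
- exact: noise_second_moment.
- have bound i : `|u i + v i * (K * Ssum m i)| <=
      4 * r ^+ 2 * (z i * (b ^+ 2 + K) + z0 i * (b0 ^+ 2 + K)).
    have S0 := Ssum_gt0 m i; have S1 := Ssum_ge1 m i.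
    have zz : 0 <= 4 * r ^+ 2 * (z i + z0 i) * K by exact: mulr_ge0.
    have -> : v i * (K * Ssum m i) = 4 * r ^+ 2 * (z i + z0 i) * K / Ssum m i.
      by rewrite /v; field; rewrite gt_eqF.
    rewrite ger0_norm; last by apply: addr_ge0 => //; exact: divr_ge0 zz (ltW S0).
    have : 4 * r ^+ 2 * (z i + z0 i) * K / Ssum m i <= 4 * r ^+ 2 * (z i + z0 i) * K.
      by rewrite ler_pdivrMr// ler_peMr.
    by rewrite /u; lra.
  apply: (le_cvg0 bound).
  rewrite -(mulr0 (4 * r ^+ 2)); apply: cvgMr.
  by rewrite -(addr0 0); apply: cvgD; exact: cvg0Ml.
Qed.

End discrepancy.

(** * The random sample variance and the optimal inflation *)

Section spenkf.
Context d (T : measurableType d) (R : realType) (Q : probability T R).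
Context (N : nat) (alpha pt0 : R) (a : 'I_N -> {RV Q >-> R}).
Hypotheses (pt0_gt0 : 0 < pt0) (N_eq : N%:R = 2 * alpha) (alpha_gt1 : 1 < alpha).
Hypothesis a_law : independent_normal a (fun=> 0) pt0.

Let alpha_gt0 : 0 < alpha := lt_trans ltr01 alpha_gt1.

Lemma measurable_sample_variance : measurable_fun setT (sample_variance a).
Proof.
apply: measurable_funM => //; apply: measurable_sum => j.
exact: measurable_funX.
Qed.

Lemma sample_variance_ge0 x : 0 <= sample_variance a x.
Proof.
by rewrite mulr_ge0 ?invr_ge0// sumr_ge0// => j _; exact: sqr_ge0.
Qed.

Let w x := alpha / pt0 * sample_variance a x.

Let mw : measurable_fun setT w.
Proof. by apply: measurable_funM => //; exact: measurable_sample_variance. Qed.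

Let w_ge0 x : 0 <= w x.
Proof. by rewrite mulr_ge0 ?sample_variance_ge0// divr_ge0// ltW. Qed.

Let laplace l : 0 <= l ->
  (\int[Q]_x (expR (- (l * w x)))%:E = ((1 + l) `^ (- alpha))%:E)%E.
Proof. exact: sample_variance_laplace. Qed.

Lemma sample_variance_ae_gt0 : {ae Q, forall x, 0 < sample_variance a x}.
Proof.
apply: filterS (gamma_ae_gt0 alpha_gt1 mw w_ge0 laplace) => x.
by rewrite /w pmulr_rgt0// divr_gt0.
Qed.

Lemma sample_variance_inv_expectation :
  (\int[Q]_x ((sample_variance a x)^-1)%:E = (alpha / pt0 * (alpha - 1)^-1)%:E)%E.
Proof.
rewrite EFinM -(gamma_expectation_inv alpha_gt1 mw w_ge0 laplace).
have ap0 : 0 < alpha / pt0 by rewrite divr_gt0.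
rewrite -ge0_integralZl ?lee_fin ?(ltW ap0)//; first last.
- by move=> x _; rewrite lee_fin invr_ge0.
- by apply/measurable_EFinP; exact: measurable_fun_inv_ge0.
by apply: eq_integral => x _;
  rewrite -EFinM /w [(_ * sample_variance a x)^-1]invfM mulVKf ?gt_eqF.
Qed.

Variables (r p0 : R) (m : nat -> R).
Hypotheses (r_gt0 : 0 < r) (p0_gt0 : 0 < p0).

Let z i := scaled_expint_inv (alpha + 1) (Ssum m i * p0 / (alpha * (Ssum m i * p0 + r))).

(** The argument of the inverse is 1 / alpha times a ratio strictly between 0 and 1, so it lies in
    the range where the inverse is known to be exact. *)
Let zP i : 0 < z i /\
  scaled_expint (alpha + 1) (z i) = Ssum m i * p0 / (alpha * (Ssum m i * p0 + r)).
Proof.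
have Sp0 : 0 < Ssum m i * p0 by rewrite mulr_gt0// Ssum_gt0.
have D0 : 0 < Ssum m i * p0 + r by rewrite addr_gt0.
apply: scaled_expint_invP => //; apply/andP; split.
  by rewrite divr_gt0// mulr_gt0.
by rewrite ltr_pdivrMr ?mulr_gt0// mulKf ?gt_eqF// ltrDl.
Qed.

Lemma theta_gt0 i : 0 < theta alpha r p0 pt0 m i.
Proof.
have [z0 _] := zP i.
by rewrite invr_gt0 mulr_gt0// divr_gt0 ?mulr_gt0 ?Ssum_gt0.
Qed.

(** Since theta_i = alpha r / (S_i pt0 z_i), the factor r / (r + S_i theta_i v) equals z_i / (z_i +
    w). As both filters start from the mean [x], the discrepancy is [A] times the expectation of w /
    (z_i + w) minus that ratio itself: the choice of z_i makes this expectation S_i p0 / (S_i p0 +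
    r). *)
Lemma optimal_discrepancy_expectation0 (y : nat -> R) x i :
  ('E_Q[fun e => (kf_analysis_mean m r y x
     (theta alpha r p0 pt0 m i * sample_variance a e) i
     - kf_analysis_mean m r y x p0 i)%R] = 0)%E.
Proof.
have [z0 zE] := zP i; have S0 := Ssum_gt0 m i.
have Sp0 : 0 < Ssum m i * p0 by rewrite mulr_gt0.
have th0 := theta_gt0 i.
have ratio_bound e : 0 <= w e / (z i + w e) <= 1.
  have zw : 0 < z i + w e by rewrite ltr_pwDl.
  by rewrite divr_ge0 ?(ltW zw)//= ler_pdivrMr// mul1r lerDr ltW.
have mratio : measurable_fun setT (fun e => w e / (z i + w e)).
  apply: measurable_funM => //; apply: measurable_fun_inv_ge0 => [|e].
    exact: measurable_funD.
  by rewrite addr_ge0// ltW.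
have [e1 [e2 [E1 _ lin _]]] := bounded_rv_moments Q mratio ratio_bound.
have := gamma_expectation_ratio alpha_gt1 mw w_ge0 laplace z0.
rewrite E1 zE => -[e1E].
pose A := Mprod m i * (x - Bsum m y i / Ssum m i).
transitivity (\int[Q]_e (- A * (w e / (z i + w e)) + A * e1)%:E)%E; last first.
  by rewrite lin mulNr addNr.
rewrite expectationE; apply: eq_integral => e _; congr (_%:E).
have v0 := sample_variance_ge0 e.
have tv0 := mulr_ge0 (ltW th0) v0.
rewrite (kf_analysis_meanB _ _ _ _ r_gt0 tv0).
rewrite (kf_analysis_meanB _ _ _ _ r_gt0 (ltW p0_gt0)) e1E /A.
have -> : (r + Ssum m i * (theta alpha r p0 pt0 m i * sample_variance a e))^-1 =
    z i / (z i + w e) / r.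
  have zw : 0 < z i + w e by rewrite ltr_pwDl.
  rewrite /theta -/(z i) /w in zw *.
  have ar0 : 0 <= alpha * sample_variance a e by rewrite mulr_ge0// ltW.
  by field; rewrite !gt_eqF//= ltr_pwDl ?mulr_gt0// mulrAC mulr_ge0// ltW.
have zw : z i + w e != 0 by rewrite gt_eqF// ltr_pwDl.
have D0 : r + Ssum m i * p0 != 0 by rewrite gt_eqF// addr_gt0.
have -> : alpha * (Ssum m i * p0 / (alpha * (Ssum m i * p0 + r))) =
    Ssum m i * p0 / (r + Ssum m i * p0).
  by rewrite [_ * p0 + r]addrC; field; rewrite D0 gt_eqF.
by field; rewrite D0 zw !gt_eqF.
Qed.

End spenkf.

(** * Assembly: ensemble moments first, then limits over the observations *)

Theorem mainTheorem7 (R : realType)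
                                                                        
  (d d' : measure_display) (Omega : measurableType d) (Xi : measurableType d')
  (P : probability Omega R) (Q : probability Xi R)
  (m : nat -> R) (r p0 pt0 x0 xt0 xtrue0 : R) (N : nat) (alpha : R)
  (y : nat -> {RV P >-> R}) (a : 'I_N -> {RV Q >-> R})
  (m_neq0 : forall i, m i != 0)
  (r_gt0 : 0 < r) (p0_gt0 : 0 < p0) (pt0_gt0 : 0 < pt0)
  (N_eq : N%:R = 2 * alpha) (alpha_gt1 : 1 < alpha)
  (y_law : independent_normal y (truth m xtrue0) r)
  (a_law : independent_normal a (fun _ => 0) pt0) :
  let v : Xi -> R := sample_variance a in
  let yw : Omega -> nat -> R := fun w i => y i w in
  let xa : nat -> Omega -> R :=
    fun i w => kf_analysis_mean m r (yw w) x0 p0 i in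
                                       
  let Dx : nat -> Omega -> Xi -> R :=
    fun i w e => kf_analysis_mean m r (yw w) xt0 (v e) i - xa i w in
  let th : nat -> R := theta alpha r p0 pt0 m in
                                                                       
  let Dxopt : nat -> Omega -> Xi -> R :=
    fun i w e =>
      corrected_analysis_mean m r (yw w) xt0 (v e)
        (opt_inflation th m r (v e)) (opt_correction th m r (yw w) xt0 (v e)) i
      - xa i w in
  [/\ cvg0_in_probability P (fun i w => 'E_Q[Dx i w])%E,
      (limn_esup (fun i => ((i.+1)%:R / Ssum m i)%:E) < +oo)%E ->
        cvg0_almost_surely P (fun i w => 'E_Q[Dx i w])%E,
      xt0 = x0 -> forall i w, ('E_Q[Dxopt i w] = 0)%E
    & cvg0_in_probability P (fun i w => 'E_Q[(fun e => Dx i w e ^+ 2)%R])%E].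
Proof.
move=> v yw xa Dx th Dxopt.
have pt_alpha := sample_variance_inv_expectation pt0_gt0 N_eq alpha_gt1 a_law.
have mv := measurable_sample_variance a.
have v_ge0 := sample_variance_ge0 a.
have v_gt0 := sample_variance_ae_gt0 pt0_gt0 N_eq alpha_gt1 a_law.
have [e1 [e2 [e1_bound e2_ge0 e2_cvg0 lin quad]]] :=
  inv_affine_moments m r_gt0 mv v_ge0 v_gt0 pt_alpha.
have DxE i w e := discrepancyE m r_gt0 y xtrue0 xt0 x0 p0_gt0 i w (v_ge0 e).
pose b := xt0 - xtrue0; pose b0 := x0 - xtrue0.
pose W := noise m y xtrue0.
pose A i w := Mprod m i * r * (b - W i w / Ssum m i).
pose B i w := - (Mprod m i * r * (b0 - W i w / Ssum m i) * (r + Ssum m i * p0)^-1).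
have meanE i w : ('E_Q[Dx i w] = (A i w * e1 i + B i w)%:E)%E.
  by rewrite expectationE -lin; apply: eq_integral => e _; rewrite /Dx /xa DxE.
have sqrE i w : ('E_Q[(fun e => Dx i w e ^+ 2)%R] =
    (A i w ^+ 2 * e2 i + 2 * A i w * B i w * e1 i + B i w ^+ 2)%:E)%E.
  by rewrite expectationE -quad; apply: eq_integral => e _; rewrite /Dx /xa DxE.
have fE : (fun i w => 'E_Q[Dx i w])%E = (fun i w => (A i w * e1 i + B i w)%:E).
  by apply/funext => i; apply/funext => w.
split.
- rewrite fE.
  apply: (mean_discrepancy_cvg0_in_probability r_gt0 y_law p0_gt0 e1_bound) => i w.
  exact: mean_discrepancyE.
- move=> _; rewrite fE.
  apply: (mean_discrepancy_cvg0_almost_surely r_gt0 y_law p0_gt0 e1_bound) => i w.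
  exact: mean_discrepancyE.
- move=> xtx0 i w.
  have th0 j : 0 < th j := theta_gt0 pt0_gt0 alpha_gt1 m r_gt0 p0_gt0 j.
  rewrite -[RHS](optimal_discrepancy_expectation0 pt0_gt0 N_eq alpha_gt1 a_law m r_gt0
    p0_gt0 (yw w) x0 i).
  rewrite !expectationE; apply: eq_integral => e _; congr (_%:E).
  by rewrite /Dxopt corrected_analysis_meanE// xtx0.
- rewrite (_ : (fun i w => _) = (fun i w =>
    (A i w ^+ 2 * e2 i + 2 * A i w * B i w * e1 i + B i w ^+ 2)%:E)); last first.
    by apply/funext => i; apply/funext => w; exact: sqrE.
  apply: (sqr_discrepancy_cvg0_in_probability r_gt0 y_law p0_gt0 e2_ge0 e2_cvg0) => //.
  (* The quadratic form in [s] and [t] is nonnegative as the ensemble expectation of a square. *)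
  move=> i s t; rewrite -lee_fin -quad; apply: integral_ge0 => e _.
  by rewrite lee_fin sqr_ge0.
Qed.
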